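(* (a) The category $\mathcal{C}_{\mathrm H}(R)$ of admissible chain complexes, with injective chain maps (between admissible complexes) as cofibrations and quasi-isomorphisms as weak equivalences, is a category with cofibrations and weak equivalences in the sense of Waldhausen, satisfying the saturation axiom and the extension axiom. (b) The usual mapping cylinder construction for chain complexes provides a cylinder functor on $\mathcal{C}_{\mathrm H}(R)$ satisfying the cylinder axiom.
   Context: $R$ is an arbitrary unital commutative Noetherian integral domain with field of fractions $Q$; $\mathbb{N}=\{1,2,3,\dots\}$. The rank of an $R$-module $A$ is $\mathrm{rank}\,A=\dim_Q(A\otimes_R Q)$. Let $M=(m_{i,j})_{i,j\in\mathbb{N}}$ be the Cesàro matrix: $m_{i,j}=1/i$ if $i\ge j$ and $m_{i,j}=0$ otherwise. A real sequence $\mathbf a=(a_n)_{n\in\mathbb{N}}$ is H-convergent if $M^k\mathbf a$ converges for some integer $k>0$; its H-limit is $\lim M^k\mathbf a$ for sufficiently large $k$ (independent of $k$). An H-null sequence is an H-convergent sequence with H-limit $0$. A chain complex $C$ of $R$-modules is admissible if $C_n=0$ for $n<0$, all homology modules $H_nC$ are finitely generated, the sequence $\big((-1)^{n-1}\,\mathrm{rank}\,H_{n-1}C\big)_{n\in\mathbb{N}}$ is H-convergent, and the sequence $\big(\tfrac1n\mathrm{rank}\,H_{n-1}C\big)_{n\in\mathbb{N}}$ is H-null. $\mathcal{C}_{\mathrm H}(R)$ is the category of admissible chain complexes and arbitrary chain maps. Waldhausen's axioms for a category with zero object $*$ and subcategories of cofibrations and weak equivalences. Cof 1: isomorphisms are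 cofibrations. Cof 2: $*\to A$ is a cofibration for every $A$. Cof 3: for a cofibration $A\to B$ and any map $A\to C$ the pushout $C\cup_A B$ exists, and $C\to C\cup_A B$ is a cofibration. Weq 1: isomorphisms are weak equivalences. Weq 2 (gluing lemma): given a commutative diagram from $B\leftarrow A\to C$ to $B'\leftarrow A'\to C'$, with $A\to B$ and $A'\to B'$ cofibrations and all three maps $A\to A'$, $B\to B'$, $C\to C'$ weak equivalences, the induced map $B\cup_A C\to B'\cup_{A'}C'$ is a weak equivalence. Saturation axiom: if $a,b$ are composable and two of $a$, $b$, $ab$ are weak equivalences, then so is the third. Extension axiom: for a map of cofibration sequences from $A\to B\to B/A$ to $A'\to B'\to B'/A'$, if $A\to A'$ and $B/A\to B'/A'$ are weak equivalences then so is $B\to B'$. A cylinder functor assigns functorially to each arrow $f\colon A\to B$ an object $T(f)$ with natural maps $j_1\colon A\to T(f)$, $j_2\colon B\to T(f)$, $p\colon T(f)\to B$ such that $pj_1=f$, $pj_2=\mathrm{id}_B$, and such that: (Cyl 1) $f\mapsto(A\vee B\to T(f))$, given by $j_1,j_2$ on the coproduct, is an exact functor from the arrow category (cofibrations and weak equivalences componentwise) to the category of cofibrations $X\to Y$ (weak equivalences componentwise; a map $(X\to Y)\to(X'\to Y')$ is a cofibration if $X\to X'$ and $X'\cup_X Y\to Y'$ are cofibrations), where exact means preserving the zero object, cofibrations, weak equivalences and pushouts along cofibrations; (Cyl 2) $T( *\to A)=A$ with $j_2$ and $p$ the identity. The cylinder axiom says that $p\colon T(f)\to B$ is a weak equivalence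 for every $f$. The usual mapping cylinder of a chain map $f\colon C\to D$ is $T(f)_n=C_n\oplus C_{n-1}\oplus D_n$ with differential $(x,x',y)\mapsto(dx-x',\,-dx',\,dy+f(x'))$, with $j_1(x)=(x,0,0)$, $j_2(y)=(0,0,y)$, $p(x,x',y)=f(x)+y$. *)

(* Defs.v *)
From HB Require Import structures.
From mathcomp Require Import all_boot all_order all_algebra.
From mathcomp Require Import boolp classical_sets reals topology normedtype.
From mathcomp Require Import sequences.

Set Implicit Arguments.
Unset Strict Implicit.
Unset Printing Implicit Defensive.

Import Order.TTheory GRing.Theory Num.Theory.
Import numFieldNormedType.Exports.
Local Open Scope classical_set_scope.
Local Open Scope ring_scope.
Local Open Scope quotient_scope.

Declare Scope cat_scope.
Delimit Scope cat_scope with cat.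
Local Open Scope cat_scope.

Record category := Category {
  ob :> Type;
  hom : ob -> ob -> Type;
  idm : forall A, hom A A;
  comp : forall A B C, hom B C -> hom A B -> hom A C;
  compA : forall A B C D (h : hom C D) (g : hom B C) (f : hom A B),
    comp h (comp g f) = comp (comp h g) f;
  comp1f : forall A B (f : hom A B), comp (idm B) f = f;
  compf1 : forall A B (f : hom A B), comp f (idm A) = f
}.
Arguments hom {c}.
Arguments idm {c}.
Arguments comp {_ A B C}.

Notation "g \oc f" := (comp g f)
  (at level 50, left associativity, format "g  \oc  f") : cat_scope.

Section CategoryNotions.
Variable C : category.
Implicit Types A B D P X Z : C.

Definition is_iso A B (f : hom A B) : Prop :=
  exists g : hom B A, g \oc f = idm A /\ f \oc g = idm B.

Definition is_zero Z : Prop :=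
  (forall A, exists! f : hom Z A, True) /\
  (forall A, exists! f : hom A Z, True).

(* P, with the legs u and v, is a pushout of B <-f- A -g-> D *)
Definition is_pushout A B D P (f : hom A B) (g : hom A D)
    (u : hom B P) (v : hom D P) : Prop :=
  u \oc f = v \oc g /\
  forall X (x : hom B X) (y : hom D X), x \oc f = y \oc g ->
    exists! h : hom P X, h \oc u = x /\ h \oc v = y.

(* A functorial choice of coproducts A v B. *)
Record coproducts := Coproducts {
  cosum : C -> C -> C;
  coin1 : forall A B, hom A (cosum A B);
  coin2 : forall A B, hom B (cosum A B);
  copair : forall A B X, hom A X -> hom B X -> hom (cosum A B) X;
  copair1 : forall A B X (f : hom A X) (g : hom B X),
    copair f g \oc coin1 A B = f;
  copair2 : forall A B X (f : hom A X) (g : hom B X),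
    copair f g \oc coin2 A B = g;
  copair_uniq : forall A B X (h k : hom (cosum A B) X),
    h \oc coin1 A B = k \oc coin1 A B -> h \oc coin2 A B = k \oc coin2 A B ->
    h = k
}.

Definition cosum_map (S : coproducts) A B A' B' (a : hom A A') (b : hom B B') :
    hom (cosum S A B) (cosum S A' B') :=
  copair S (coin1 S A' B' \oc a) (coin2 S A' B' \oc b).

End CategoryNotions.

Record functor (C D : category) := Functor {
  fob :> C -> D;
  fhom : forall A B, hom A B -> hom (fob A) (fob B);
  fhom1 : forall A, fhom (idm A) = idm (fob A);
  fhomM : forall A B E (g : hom B E) (f : hom A B),
    fhom (g \oc f) = fhom g \oc fhom f
}.
Arguments fhom {C D} _ {A B}.

Record nattrans (C D : category) (F G : functor C D) := NatTrans {
  ntr :> forall A, hom (F A) (G A);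
  ntr_nat : forall A B (f : hom A B), ntr B \oc fhom F f = fhom G f \oc ntr A
}.

Section FullSubcategory.
Variables (C : category) (P : C -> Prop).

Definition full_subcategory : category :=
  @Category {A : C | P A} (fun A B => hom (sval A) (sval B))
    (fun A => idm (sval A)) (fun A B D g f => g \oc f)
    (fun A B D E h g f => compA h g f) (fun A B f => comp1f f)
    (fun A B f => compf1 f).

End FullSubcategory.

Section ArrowCategory.
Variable C : category.

Record arrow := Arrow { src : C; tgt : C; arr : hom src tgt }.

Record square (f g : arrow) := Square {
  sq_src : hom (src f) (src g);
  sq_tgt : hom (tgt f) (tgt g);
  sq_comm : sq_tgt \oc arr f = arr g \oc sq_src
}.

Lemma square_eq f g (s t : square f g) :
  sq_src s = sq_src t -> sq_tgt s = sq_tgt t -> s = t.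
Proof.
case: s t => [a b h] [a' b' h'] /= ea eb; move: h h'; rewrite ea eb => h h'.
by rewrite (Prop_irrelevance h h').
Qed.

Lemma square_id_subproof f : idm (tgt f) \oc arr f = arr f \oc idm (src f).
Proof. by rewrite comp1f compf1. Qed.

Definition square_id f : square f f := Square (square_id_subproof f).

Lemma square_comp_subproof f g h (t : square g h) (s : square f g) :
  (sq_tgt t \oc sq_tgt s) \oc arr f = arr h \oc (sq_src t \oc sq_src s).
Proof. by rewrite -compA sq_comm compA sq_comm compA. Qed.

Definition square_comp f g h (t : square g h) (s : square f g) : square f h :=
  Square (square_comp_subproof t s).

Definition arrow_category : category.
Proof.
refine (@Category arrow square square_id square_comp _ _ _) => *;
  by apply: square_eq; rewrite /= ?compA ?comp1f ?compf1.
Defined.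

Definition src_functor : functor arrow_category C :=
  @Functor arrow_category C src (fun _ _ s => sq_src s)
    (fun _ => erefl) (fun _ _ _ _ _ => erefl).

Definition tgt_functor : functor arrow_category C :=
  @Functor arrow_category C tgt (fun _ _ s => sq_tgt s)
    (fun _ => erefl) (fun _ _ _ _ _ => erefl).

End ArrowCategory.

(* Bare data; the axioms are [is_waldhausen], [saturation] and [extension].   *)
Record cwcategory := CWCategory {
  cwcat :> category;
  cof : forall A B : cwcat, hom A B -> Prop;
  weq : forall A B : cwcat, hom A B -> Prop
}.
Arguments cof {c A B}.
Arguments weq {c A B}.

Section WaldhausenAxioms.
Variable W : cwcategory.

(* The zero object is unique up to a unique isomorphism; rather than fixing   *)
(* one, the axioms quantify over all zero objects.                            *)
Record is_waldhausen : Prop := IsWaldhausen {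
  has_zero : exists Z : W, is_zero Z;
  cof_comp : forall (A B D : W) (f : hom A B) (g : hom B D),
    cof f -> cof g -> cof (g \oc f);
  weq_comp : forall (A B D : W) (f : hom A B) (g : hom B D),
    weq f -> weq g -> weq (g \oc f);
  Cof1 : forall (A B : W) (f : hom A B), is_iso f -> cof f;
  Cof2 : forall (Z A : W) (f : hom Z A), is_zero Z -> cof f;
  Cof3 : forall (A B D : W) (f : hom A B) (g : hom A D), cof f ->
    (exists (P : W) (u : hom B P) (v : hom D P), is_pushout f g u v) /\
    (forall (P : W) (u : hom B P) (v : hom D P), is_pushout f g u v -> cof v);
  Weq1 : forall (A B : W) (f : hom A B), is_iso f -> weq f;
  Weq2 : forall (A B D A' B' D' : W)
      (f : hom A B) (g : hom A D) (f' : hom A' B') (g' : hom A' D')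
      (a : hom A A') (b : hom B B') (d : hom D D'),
    b \oc f = f' \oc a -> d \oc g = g' \oc a ->
    cof f -> cof f' -> weq a -> weq b -> weq d ->
    forall (P P' : W) (u : hom B P) (v : hom D P)
      (u' : hom B' P') (v' : hom D' P') (h : hom P P'),
    is_pushout f g u v -> is_pushout f' g' u' v' ->
    h \oc u = u' \oc b -> h \oc v = v' \oc d -> weq h
}.

Definition saturation : Prop :=
  forall (A B D : W) (f : hom A B) (g : hom B D),
    [/\ weq f -> weq g -> weq (g \oc f),
        weq f -> weq (g \oc f) -> weq g &
        weq g -> weq (g \oc f) -> weq f].

(* A >-f-> B -q-> E, where E is a pushout B / A of B along A -> *. *)
Definition cofibration_sequence (A B E : W) (f : hom A B) (q : hom B E) : Prop :=
  cof f /\ exists (Z : W) (z : hom A Z) (s : hom Z E),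
    is_zero Z /\ is_pushout f z q s.

Definition extension : Prop :=
  forall (A B E A' B' E' : W)
      (f : hom A B) (q : hom B E) (f' : hom A' B') (q' : hom B' E')
      (a : hom A A') (b : hom B B') (e : hom E E'),
    cofibration_sequence f q -> cofibration_sequence f' q' ->
    b \oc f = f' \oc a -> e \oc q = q' \oc b ->
    weq a -> weq e -> weq b.

Definition arrow_cw : cwcategory :=
  @CWCategory (arrow_category W)
    (fun _ _ s => cof (sq_src s) /\ cof (sq_tgt s))
    (fun _ _ s => weq (sq_src s) /\ weq (sq_tgt s)).

(* The category of cofibrations X >-> Y; a map to X' >-> Y' is a cofibration  *)
(* when X -> X' and X' u_X Y -> Y' are cofibrations.                          *)
Definition cofibration_category : category :=
  @full_subcategory (arrow_category W) (fun f => cof (arr f)).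

Definition cofibration_map_cof (f g : cofibration_category) (s : hom f g) :
    Prop :=
  cof (sq_src s) /\
  exists (P : W) (u : hom (src (sval g)) P) (v : hom (tgt (sval f)) P)
      (h : hom P (tgt (sval g))),
    [/\ is_pushout (sq_src s) (arr (sval f)) u v,
        h \oc u = arr (sval g), h \oc v = sq_tgt s & cof h].

Definition cofibration_cw : cwcategory :=
  @CWCategory cofibration_category cofibration_map_cof
    (fun _ _ s => weq (sq_src s) /\ weq (sq_tgt s)).

End WaldhausenAxioms.

Record exact_functor (V W : cwcategory) (F : functor V W) : Prop := ExactFunctor {
  exact_zero : forall Z : V, is_zero Z -> is_zero (F Z);
  exact_cof : forall (A B : V) (f : hom A B), cof f -> cof (fhom F f);
  exact_weq : forall (A B : V) (f : hom A B), weq f -> weq (fhom F f);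
  exact_pushout : forall (A B D P : V) (f : hom A B) (g : hom A D)
      (u : hom B P) (v : hom D P),
    cof f -> is_pushout f g u v ->
    is_pushout (fhom F f) (fhom F g) (fhom F u) (fhom F v)
}.

Record cylinder (C : category) := Cylinder {
  cyl_ob :> functor (arrow_category C) C;
  cyl_j1 : nattrans (src_functor C) cyl_ob;
  cyl_j2 : nattrans (tgt_functor C) cyl_ob;
  cyl_p : nattrans cyl_ob (tgt_functor C);
  cyl_pj1 : forall f : arrow C, cyl_p f \oc cyl_j1 f = arr f;
  cyl_pj2 : forall f : arrow C, cyl_p f \oc cyl_j2 f = idm (tgt f)
}.

Section CylinderAxioms.
Variables (W : cwcategory) (T : cylinder W) (S : coproducts W).

(* For f : A -> B, the arrow A v B -> T(f). *)
Definition cyl_front (f : arrow W) : arrow W :=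
  Arrow (copair S (cyl_j1 T f) (cyl_j2 T f)).

Lemma cyl_front_subproof (f g : arrow W) (s : square f g) :
  fhom T s \oc arr (cyl_front f) =
  arr (cyl_front g) \oc cosum_map S (sq_src s) (sq_tgt s).
Proof.
apply: (copair_uniq (c := S)); rewrite -!compA ?copair1 ?copair2 compA.
- by rewrite copair1 -(ntr_nat (cyl_j1 T) s).
- by rewrite copair2 -(ntr_nat (cyl_j2 T) s).
Qed.

Definition cyl_front_map (f g : arrow W) (s : square f g) :
  square (cyl_front f) (cyl_front g) :=
  @Square W (cyl_front f) (cyl_front g)
    (cosum_map S (sq_src s) (sq_tgt s)) (fhom T s) (cyl_front_subproof s).

Definition cyl_front_functor (hcof : forall f, cof (arr (cyl_front f))) :
  functor (arrow_cw W) (cofibration_cw W).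
Proof.
refine (@Functor (arrow_cw W) (cofibration_cw W)
  (fun f => exist _ (cyl_front f) (hcof f))
  (fun f g s => cyl_front_map s) _ _).
- move=> f; apply: square_eq => /=; last exact: (fhom1 T).
  by apply: (copair_uniq (c := S)); rewrite ?copair1 ?copair2 comp1f compf1.
- move=> f g h t s; apply: square_eq => /=; last exact: (fhomM T).
  by apply: (copair_uniq (c := S));
    rewrite -!compA ?copair1 ?copair2 !compA ?copair1 ?copair2.
Defined.

End CylinderAxioms.

Definition Cyl1 (W : cwcategory) (T : cylinder W) : Prop :=
  exists (S : coproducts W) (hcof : forall f, cof (arr (cyl_front T S f))),
    exact_functor (cyl_front_functor hcof).

(* The requirement that T(Z -> A) be A, with j_2 and p the identity, for a     *)
(* zero object Z, is read up to the canonical identification along j_2: the   *)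
(* mapping cylinder of 0 -> A is 0 + 0 + A. With [cyl_pj2], it says that j_2  *)
(* and p are mutually inverse.                                                *)
Definition Cyl2 (W : cwcategory) (T : cylinder W) : Prop :=
  forall f : arrow W, is_zero (src f) -> cyl_j2 T f \oc cyl_p T f = idm (T f).

Definition is_cylinder_functor (W : cwcategory) (T : cylinder W) : Prop :=
  Cyl1 T /\ Cyl2 T.

Definition cylinder_axiom (W : cwcategory) (T : cylinder W) : Prop :=
  forall f : arrow W, weq (cyl_p T f).

Section CylinderRestriction.
Variables (C : category) (P : C -> Prop) (T : cylinder C).
Hypothesis PT : forall f : arrow C, P (src f) -> P (tgt f) -> P (T f).
Let CP := full_subcategory P.

Definition arrow_incl (f : arrow CP) : arrow C :=
  @Arrow C (sval (src f)) (sval (tgt f)) (arr f).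

Definition square_incl (f g : arrow CP) (s : square f g) :
    square (arrow_incl f) (arrow_incl g) :=
  @Square C (arrow_incl f) (arrow_incl g) (sq_src s) (sq_tgt s) (sq_comm s).

Definition cyl_restrict_ob : functor (arrow_category CP) CP.
Proof.
refine (@Functor (arrow_category CP) CP
  (fun f => exist _ (T (arrow_incl f))
    (@PT (arrow_incl f) (svalP (src f)) (svalP (tgt f))))
  (fun f g s => fhom T (square_incl s)) _ _).
- move=> f; rewrite -[RHS]/(idm (T (arrow_incl f))) -fhom1.
  by congr fhom; apply: square_eq.
- move=> f g h t s.
  rewrite -[RHS]/(fhom T (square_incl t) \oc fhom T (square_incl s)) -fhomM.
  by congr fhom; apply: square_eq.
Defined.

Definition cyl_restrict : cylinder CP :=
  @Cylinder CP cyl_restrict_ob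
    (@NatTrans _ _ (src_functor CP) cyl_restrict_ob
      (fun f => cyl_j1 T (arrow_incl f))
      (fun f g s => ntr_nat (cyl_j1 T) (square_incl s)))
    (@NatTrans _ _ (tgt_functor CP) cyl_restrict_ob
      (fun f => cyl_j2 T (arrow_incl f))
      (fun f g s => ntr_nat (cyl_j2 T) (square_incl s)))
    (@NatTrans _ _ cyl_restrict_ob (tgt_functor CP)
      (fun f => cyl_p T (arrow_incl f))
      (fun f g s => ntr_nat (cyl_p T) (square_incl s)))
    (fun f => cyl_pj1 T (arrow_incl f))
    (fun f => cyl_pj2 T (arrow_incl f)).

End CylinderRestriction.

Definition is_ideal (R : comNzRingType) (I : set R) : Prop :=
  [/\ I 0, forall x y, I x -> I y -> I (x + y) & forall a x, I x -> I (a * x)].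

Definition noetherian (R : comNzRingType) : Prop :=
  forall I : set R, is_ideal I ->
    exists (n : nat) (g : 'I_n -> R), (forall i, I (g i)) /\
      forall x, I x -> exists c : 'I_n -> R, x = \sum_(i < n) c i * g i.

Definition fin_generated (R : comNzRingType) (A : lmodType R) : Prop :=
  exists (n : nat) (g : 'I_n -> A),
    forall x, exists c : 'I_n -> R, x = \sum_(i < n) c i *: g i.

Section QuotientModule.
Variables (R : pzRingType) (V : lmodType R) (N : {pred V}).
Hypothesis N_submod : submod_closed N.

Let NZ := GRing.isZmodClosed.Build V N (GRing.submod_closedB N_submod).
Definition quotmod_pred : zmodClosed V := HB.pack (N : V -> bool) NZ.

Definition quotmod := Quotient.quot quotmod_pred.
HB.instance Definition _ := GRing.Zmodule.on quotmod.
HB.instance Definition _ := ZmodQuotient.on quotmod.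

Definition quotmod_scale (a : R) (x : quotmod) : quotmod :=
  \pi_quotmod (a *: repr x).

Lemma quotmod_eqP (x y : V) :
  reflect (\pi_quotmod x = \pi_quotmod y) (x - y \in N).
Proof.
rewrite -[N]/(quotmod_pred : {pred V}) Quotient.idealrBE; exact: eqP.
Qed.

Lemma pi_quotmodZ a x : \pi_quotmod (a *: x) = quotmod_scale a (\pi_quotmod x).
Proof.
apply/quotmod_eqP; rewrite -scalerBr.
apply: (GRing.subsemimod_closedZ (GRing.submod_closed_semi N_submod)).
by apply/quotmod_eqP; rewrite reprK.
Qed.

Lemma quotmod_scaleA a b x :
  quotmod_scale a (quotmod_scale b x) = quotmod_scale (a * b) x.
Proof.
rewrite -[x]reprK -(pi_quotmodZ b) -!(pi_quotmodZ _ (_ *: _)) -pi_quotmodZ.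
by rewrite scalerA.
Qed.

Lemma quotmod_scale1 : left_id 1 quotmod_scale.
Proof. by move=> x; rewrite -[x]reprK -pi_quotmodZ scale1r. Qed.

Lemma quotmod_scaleDr : right_distributive quotmod_scale +%R.
Proof.
move=> a x y; rewrite -[x]reprK -[y]reprK -raddfD /=.
by rewrite -!pi_quotmodZ scalerDr raddfD.
Qed.

Lemma quotmod_scaleDl x : {morph quotmod_scale^~ x : a b / a + b}.
Proof. by move=> a b /=; rewrite -[x]reprK -!pi_quotmodZ scalerDl raddfD. Qed.

HB.instance Definition _ := GRing.Zmodule_isLmodule.Build R quotmod
  quotmod_scaleA quotmod_scale1 quotmod_scaleDr quotmod_scaleDl.

End QuotientModule.

(* The tensor product A (x)_R Q with the field of fractions Q of R: formal    *)
(* sums of pure tensors (a, q), modulo the congruence generated by            *)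
(* commutativity, biadditivity and R-balancedness.                            *)
Section TensorFraction.
Variables (R : idomainType) (A : lmodType R).
Local Notation Q := {fraction R}.
Implicit Types s t : seq (A * Q).

Inductive tensor_rel : seq (A * Q) -> seq (A * Q) -> Prop :=
| tensor_refl s : tensor_rel s s
| tensor_sym s t : tensor_rel s t -> tensor_rel t s
| tensor_trans s t u : tensor_rel s t -> tensor_rel t u -> tensor_rel s u
| tensor_cat s s' t t' : tensor_rel s s' -> tensor_rel t t' ->
    tensor_rel (s ++ t) (s' ++ t')
| tensor_catC s t : tensor_rel (s ++ t) (t ++ s)
| tensor0l q : tensor_rel [:: (0, q)] [::]
| tensorDl a b q : tensor_rel [:: (a + b, q)] [:: (a, q); (b, q)]
| tensorDr a p q : tensor_rel [:: (a, p + q)] [:: (a, p); (a, q)]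
| tensor_balanced (r : R) a q :
    tensor_rel [:: (r *: a, q)] [:: (a, FracField.tofrac r * q)].

Definition tensor_relb s t : bool := `[< tensor_rel s t >].

Lemma tensor_relb_equiv : equiv_class_of tensor_relb.
Proof.
split=> [s|s t|t s u].
- exact/asboolP/tensor_refl.
- by apply/asboolP/asboolP; apply: tensor_sym.
- by move=> /asboolP st /asboolP tu; apply/asboolP; apply: tensor_trans st tu.
Qed.

Canonical tensor_equiv := EquivRelPack tensor_relb_equiv.
Canonical tensor_encModRel := defaultEncModRel tensor_relb.

Definition tensor_frac := {eq_quot tensor_relb}.
HB.instance Definition _ := Choice.on tensor_frac.
HB.instance Definition _ := EqQuotient.on tensor_frac.

Lemma tensor_eqP s t :
  \pi_tensor_frac s = \pi_tensor_frac t <-> tensor_rel s t.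
Proof.
split=> [/eqP|st]; first by rewrite piE => /asboolP.
by apply/eqP; rewrite piE; apply/asboolP.
Qed.

Lemma tensor_repr s : tensor_rel (repr (\pi_tensor_frac s)) s.
Proof. by apply/tensor_eqP; rewrite reprK. Qed.

Lemma tensor_opp s t : tensor_rel s t ->
  tensor_rel [seq (- p.1, p.2) | p <- s] [seq (- p.1, p.2) | p <- t].
Proof.
elim=> {s t} /=.
- by move=> s; apply: tensor_refl.
- by move=> s t _; apply: tensor_sym.
- by move=> s t u _ st _; apply: tensor_trans.
- by move=> s s' t t' _ ss' _ tt'; rewrite !map_cat; apply: tensor_cat.
- by move=> s t; rewrite !map_cat; apply: tensor_catC.
- by move=> q; rewrite oppr0; apply: tensor0l.
- by move=> a b q; rewrite opprD; apply: tensorDl.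
- by move=> a p q; apply: tensorDr.
- by move=> r a q; rewrite -scalerN; apply: tensor_balanced.
Qed.

Lemma tensor_scale (x : Q) s t : tensor_rel s t ->
  tensor_rel [seq (p.1, x * p.2) | p <- s] [seq (p.1, x * p.2) | p <- t].
Proof.
elim=> {s t} /=.
- by move=> s; apply: tensor_refl.
- by move=> s t _; apply: tensor_sym.
- by move=> s t u _ st _; apply: tensor_trans.
- by move=> s s' t t' _ ss' _ tt'; rewrite !map_cat; apply: tensor_cat.
- by move=> s t; rewrite !map_cat; apply: tensor_catC.
- by move=> q; apply: tensor0l.
- by move=> a b q; apply: tensorDl.
- by move=> a p q; rewrite mulrDr; apply: tensorDr.
- by move=> r a q; rewrite mulrCA; apply: tensor_balanced.
Qed.

Definition tensor_zero : tensor_frac := \pi_tensor_frac [::].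
Definition tensor_add (x y : tensor_frac) : tensor_frac :=
  \pi_tensor_frac (repr x ++ repr y).
Definition tensor_neg (x : tensor_frac) : tensor_frac :=
  \pi_tensor_frac [seq (- p.1, p.2) | p <- repr x].
Definition tensor_scal (q : Q) (x : tensor_frac) : tensor_frac :=
  \pi_tensor_frac [seq (p.1, q * p.2) | p <- repr x].

Lemma pi_tensorD s t : \pi_tensor_frac (s ++ t) =
  tensor_add (\pi_tensor_frac s) (\pi_tensor_frac t).
Proof.
by apply/tensor_eqP; apply: tensor_cat; apply: tensor_sym; apply: tensor_repr.
Qed.

Lemma pi_tensorN s : \pi_tensor_frac [seq (- p.1, p.2) | p <- s] =
  tensor_neg (\pi_tensor_frac s).
Proof. by apply/tensor_eqP/tensor_opp/tensor_sym/tensor_repr. Qed.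

Lemma pi_tensorZ q s : \pi_tensor_frac [seq (p.1, q * p.2) | p <- s] =
  tensor_scal q (\pi_tensor_frac s).
Proof. by apply/tensor_eqP/tensor_scale/tensor_sym/tensor_repr. Qed.

Lemma tensor_addA : associative tensor_add.
Proof.
move=> x y z; apply/tensor_eqP.
apply: tensor_trans (tensor_cat (tensor_refl _) (tensor_repr _)) _.
rewrite catA; apply: tensor_cat (tensor_refl _).
exact/tensor_sym/tensor_repr.
Qed.

Lemma tensor_addC : commutative tensor_add.
Proof. by move=> x y; apply/tensor_eqP/tensor_catC. Qed.

Lemma tensor_add0 : left_id tensor_zero tensor_add.
Proof.
move=> x; rewrite -[RHS]reprK; apply/tensor_eqP.
exact: tensor_cat (tensor_repr [::]) (tensor_refl _).
Qed.

Lemma tensor_addN : left_inverse tensor_zero tensor_neg tensor_add.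
Proof.
move=> x; apply/tensor_eqP.
apply: tensor_trans (tensor_cat (tensor_repr _) (tensor_refl _)) _.
elim: (repr x) => [|[a q] s IHs]; first exact: tensor_refl.
rewrite [map _ _]/= -(cat1s (- a, q)) -(cat1s (a, q) s) -catA.
have h := tensor_catC (map (fun p => (- p.1, p.2)) s) ([:: (a, q)] ++ s).
apply: tensor_trans (tensor_cat (tensor_refl _) h) _.
rewrite -catA catA -[[::]]cats0; apply: tensor_cat.
  apply: tensor_trans (tensor_sym (tensorDl _ _ _)) _.
  by rewrite addNr; apply: tensor0l.
exact: tensor_trans (tensor_catC _ _) IHs.
Qed.

HB.instance Definition _ := GRing.isZmodule.Build tensor_frac
  tensor_addA tensor_addC tensor_add0 tensor_addN.

Lemma tensor_scalA p q x :
  tensor_scal p (tensor_scal q x) = tensor_scal (p * q) x.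
Proof.
apply/tensor_eqP.
apply: tensor_trans (tensor_scale _ (tensor_repr _)) _.
rewrite -map_comp (eq_map (g := fun c => (c.1, p * q * c.2))).
  exact: tensor_refl.
by move=> -[a r] /=; rewrite mulrA.
Qed.

Lemma tensor_scal1 : left_id 1 tensor_scal.
Proof.
move=> x; rewrite -[RHS]reprK; congr (\pi_tensor_frac _).
by rewrite -[RHS]map_id; apply: eq_map => -[a r] /=; rewrite mul1r.
Qed.

Lemma tensor_scalDr : right_distributive tensor_scal +%R.
Proof.
move=> q x y; apply/tensor_eqP.
apply: tensor_trans (tensor_scale _ (tensor_repr _)) _.
by rewrite map_cat; apply: tensor_cat; apply: tensor_sym; apply: tensor_repr.
Qed.

Lemma tensor_scalDl x : {morph tensor_scal^~ x : p q / p + q}.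
Proof.
move=> p q; apply/tensor_eqP.
apply: tensor_trans (tensor_sym (tensor_cat (tensor_repr _) (tensor_repr _))).
elim: (repr x) => [|[a r] s IHs] /=; first exact: tensor_refl.
rewrite -(cat1s (a, (p + q) * r)) mulrDl.
apply: tensor_trans (tensor_cat (tensorDr _ _ _) IHs) _.
set sp := map _ s; set sq := map _ s.
apply: (@tensor_cat [:: _] [:: _]); first exact: tensor_refl.
rewrite -[X in tensor_rel X]cat1s -(cat1s (a, q * r) sq) !catA.
by apply: tensor_cat; [apply: tensor_catC|apply: tensor_refl].
Qed.

HB.instance Definition _ :=
  GRing.Zmodule_isLmodule.Build Q tensor_frac
    tensor_scalA tensor_scal1 tensor_scalDr tensor_scalDl.

End TensorFraction.

Definition is_basis (F : fieldType) (V : lmodType F) (n : nat) (b : 'I_n -> V) :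
  Prop := forall v, exists! c : {ffun 'I_n -> F}, v = \sum_(i < n) c i *: b i.

(* 0 when V is not finite-dimensional. *)
Definition dim (F : fieldType) (V : lmodType F) : nat :=
  xget 0%N [set n | exists b : 'I_n -> V, is_basis b].

Definition mod_rank (R : idomainType) (A : lmodType R) : nat :=
  dim (tensor_frac A).

Record chain_complex (R : pzRingType) := ChainComplex {
  cob :> int -> lmodType R;
  bd : forall n, {linear cob n -> cob (n - 1)};
  bdK : forall n x, bd (n - 1) (bd n x) = 0
}.
Arguments bd {R} c n.

Record chain_map (R : pzRingType) (C D : chain_complex R) := ChainMap {
  cmap :> forall n, C n -> D n;
  cmap_linear : forall n, linear (@cmap n);
  cmap_bd : forall n x, bd D n (cmap x) = cmap (bd C n x)
}.
Arguments cmap {R C D} _ n.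
Arguments cmap_linear {R C D} _ n.

HB.instance Definition _ (R : pzRingType) (C D : chain_complex R)
    (f : chain_map C D) n :=
  GRing.isLinear.Build R (C n) (D n) *:%R (f n) (cmap_linear f n).

Section ComplexCategory.
Variable R : pzRingType.
Implicit Types C D E : chain_complex R.

Lemma chain_map_eq C D (f g : chain_map C D) :
  (forall n x, f n x = g n x) -> f = g.
Proof.
case: f g => [f fl fd] [g gl gd] /= fg.
have {fg} : f = g by apply/functional_extensionality_dep => n; apply/funext.
move=> efg; move: fl fd gl gd; rewrite efg => fl fd gl gd.
by rewrite (Prop_irrelevance fl gl) (Prop_irrelevance fd gd).
Qed.

Definition chain_id C : chain_map C C.
Proof. by refine (@ChainMap R C C (fun n x => x) _ _). Defined.

Definition chain_comp C D E (g : chain_map D E) (f : chain_map C D) :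
  chain_map C E.
Proof.
refine (@ChainMap R C E (fun n x => g n (f n x)) _ _).
- by move=> n a x y; rewrite !linearP.
- by move=> n x; rewrite !cmap_bd.
Defined.

Definition complex_category : category.
Proof.
by refine (@Category (chain_complex R) (@chain_map R) chain_id chain_comp _ _ _)
  => *; apply: chain_map_eq.
Defined.

End ComplexCategory.

Section Homology.
Variables (R : pzRingType) (C : chain_complex R).

(* Indexing by the image avoids a cast along (n + 1) - 1 = n. *)
Inductive boundary : forall n, C n -> Prop :=
| Boundary n (y : C n) : boundary (bd C n y).

Lemma boundaryE n (x : C n) : boundary x <->
  exists y : C (n + 1), ecast i (C i) (addrK 1 n) (bd C (n + 1) y) = x.
Proof.
split; last first.
  by move=> [y <-]; move: y (addrK 1 n); move: (n + 1) => m y e;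
    case: _ / e x => x; exact: Boundary.
case=> {n x} n y.
have e : n = n - 1 + 1 by rewrite subrK.
exists (ecast i (C i) e y); move: (addrK 1 (n - 1)).
by case: _ / e => e'; rewrite eq_axiomK.
Qed.

Lemma ecast_linear m n (e : m = n) a (x y : C m) :
  ecast i (C i) e (a *: x + y) =
  a *: ecast i (C i) e x + ecast i (C i) e y.
Proof. by case: _ / e. Qed.

Variable n : int.

Definition is_cycle : pred (C n) := fun x => bd C n x == 0.

Lemma is_cycle_submod : submod_closed is_cycle.
Proof.
split=> [|a x y]; rewrite !unfold_in ?linear0// => /eqP dx /eqP dy.
by rewrite linearP dx dy scaler0 addr0.
Qed.
HB.instance Definition _ := GRing.isSubmodClosed.Build R (C n) is_cycle
  is_cycle_submod.

Definition cycles := {x : C n | is_cycle x}.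
HB.instance Definition _ := SubChoice.on cycles.
HB.instance Definition _ := [SubChoice_isSubLmodule of cycles by <:].

Definition is_boundary : pred cycles := fun z => `[< boundary (val z) >].

Lemma is_boundary_submod : submod_closed is_boundary.
Proof.
split=> [|a x y]; rewrite !unfold_in.
  apply/asboolP/boundaryE; exists 0; rewrite linear0 [RHS]/=.
  by move: (addrK 1 n); move: (n + 1 - 1) => m e; case: _ / e.
move=> /asboolP/boundaryE[x' x'E] /asboolP/boundaryE[y' y'E].
apply/asboolP/boundaryE; exists (a *: x' + y').
by rewrite linearP ecast_linear x'E y'E.
Qed.
Definition homology := quotmod is_boundary_submod.
HB.instance Definition _ := GRing.Lmodule.on homology.

End Homology.

Section HomologyMap.
Variables (R : pzRingType) (C D : chain_complex R) (f : chain_map C D) (n : int).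

Lemma cycle_map_subproof (z : cycles C n) : is_cycle (f n (val z)).
Proof. by rewrite /is_cycle cmap_bd (eqP (valP z)) linear0. Qed.

Definition cycle_map (z : cycles C n) : cycles D n :=
  Sub (f n (val z)) (cycle_map_subproof z).

Lemma cycle_map_linear : linear cycle_map.
Proof. by move=> a x y; apply/val_inj; rewrite /= linearP. Qed.

Lemma cycle_map_boundary z : is_boundary z -> is_boundary (cycle_map z).
Proof.
rewrite /is_boundary => /asboolP zB; apply/asboolP; rewrite /=.
by case: zB => m y; rewrite -cmap_bd; apply: Boundary.
Qed.

Definition homology_map (x : homology C n) : homology D n :=
  \pi_(homology D n) (cycle_map (repr x)).

Lemma pi_homology_map (z : cycles C n) :
  homology_map (\pi_(homology C n) z) = \pi_(homology D n) (cycle_map z).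
Proof.
apply/quotmod_eqP.
have -> : cycle_map (repr (\pi_(homology C n) z)) - cycle_map z =
    cycle_map (repr (\pi_(homology C n) z) - z).
  by rewrite addrC -scaleN1r -cycle_map_linear scaleN1r [- z + _]addrC.
apply: cycle_map_boundary.
by apply/(quotmod_eqP (@is_boundary_submod R C n)); exact: reprK.
Qed.

Lemma homology_map_linear : linear homology_map.
Proof.
move=> a x y; rewrite -[x]reprK -[y]reprK.
have piP (E : chain_complex R) b (u v : cycles E n) :
    b *: \pi_(homology E n) u + \pi_(homology E n) v =
    \pi_(homology E n) (b *: u + v).
  rewrite raddfD /=; congr (_ + _); exact/esym/pi_quotmodZ.
by rewrite piP !pi_homology_map cycle_map_linear piP.
Qed.
HB.instance Definition _ := GRing.isLinear.Build R (homology C n) (homology D n)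
  *:%R homology_map homology_map_linear.

End HomologyMap.

Definition quasi_iso (R : pzRingType) (C D : chain_complex R)
    (f : chain_map C D) : Prop :=
  forall n, bijective (@homology_map R C D f n).

Section MappingCylinder.
Variable R : pzRingType.

Section Object.
Variables (C D : chain_complex R) (f : chain_map C D).

Definition mapcyl_ob (n : int) : lmodType R := (C n * C (n - 1) * D n)%type.

Definition mapcyl_bd n (t : mapcyl_ob n) : mapcyl_ob (n - 1) :=
  let: (x, x', y) := t in
  (bd C n x - x', - bd C (n - 1) x', bd D n y + f (n - 1) x').

Lemma mapcyl_bd_linear n : linear (@mapcyl_bd n).
Proof.
move=> a [[x x'] y] [[z z'] w] /=; congr (_, _, _) => /=; rewrite !linearP /=.
- by rewrite scalerDr addrACA.
- by [].
- by rewrite scalerDr addrACA.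
Qed.
HB.instance Definition _ n := GRing.isLinear.Build R (mapcyl_ob n)
  (mapcyl_ob (n - 1)) *:%R (@mapcyl_bd n) (@mapcyl_bd_linear n).

Lemma mapcyl_bdK n x : @mapcyl_bd (n - 1) (@mapcyl_bd n x) = 0.
Proof.
case: x => [[x x'] y] /=; congr (_, _, _) => /=.
- by rewrite linearB /= bdK sub0r opprK addNr.
- by rewrite linearN /= bdK oppr0 oppr0.
- by rewrite linearD linearN /= bdK add0r cmap_bd addrN.
Qed.

Definition mapcyl : chain_complex R :=
  @ChainComplex R mapcyl_ob (fun n => @mapcyl_bd n) mapcyl_bdK.

Definition mapcyl_j1 : chain_map C mapcyl.
Proof.
refine (@ChainMap R C mapcyl (fun n x => (x, 0, 0)) _ _).
- by move=> n a x y; congr (_, _, _) => /=; rewrite scaler0 addr0.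
- by move=> n x /=; rewrite !linear0 !addr0.
Defined.

Definition mapcyl_j2 : chain_map D mapcyl.
Proof.
refine (@ChainMap R D mapcyl (fun n y => (0, 0, y)) _ _).
- by move=> n a x y; congr (_, _, _) => /=; rewrite scaler0 addr0.
- by move=> n x /=; rewrite !linear0 !addr0.
Defined.

Definition mapcyl_p : chain_map mapcyl D.
Proof.
refine (@ChainMap R mapcyl D (fun n t => f n t.1.1 + t.2) _ _).
- by move=> n a x y; rewrite /= linearP scalerDr addrACA.
- move=> n [[x x'] y] /=.
  by rewrite linearD linearB /= cmap_bd addrA addrAC subrK.
Defined.

End Object.

Definition mapcyl_map (f g : arrow (complex_category R)) (s : square f g) :
  chain_map (mapcyl (arr f)) (mapcyl (arr g)).
Proof.
refine (@ChainMap R (mapcyl (arr f)) (mapcyl (arr g)) (fun n t =>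
  (cmap (sq_src s) n t.1.1, cmap (sq_src s) (n - 1) t.1.2,
   cmap (sq_tgt s) n t.2)) _ _).
- by move=> n a [[x x'] y] [[z z'] w]; congr (_, _, _); rewrite /= linearP.
- move=> n [[x x'] y] /=.
  rewrite linearB linearN linearD /= !cmap_bd; congr (_, _, _ + _).
  exact: (esym (congr1 (fun h : chain_map _ _ => h (n - 1) x') (sq_comm s))).
Defined.

Definition mapcyl_functor :
  functor (arrow_category (complex_category R)) (complex_category R).
Proof.
refine (@Functor (arrow_category (complex_category R)) (complex_category R)
  (fun f => mapcyl (arr f)) mapcyl_map _ _).
- by move=> f; apply: chain_map_eq => n [[x x'] y].
- by move=> f g h t s; apply: chain_map_eq => n [[x x'] y].
Defined.

Definition mapping_cylinder : cylinder (complex_category R).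
Proof.
refine (@Cylinder (complex_category R) mapcyl_functor
  (@NatTrans _ _ (src_functor _) mapcyl_functor
    (fun f => mapcyl_j1 (arr f)) _)
  (@NatTrans _ _ (tgt_functor _) mapcyl_functor
    (fun f => mapcyl_j2 (arr f)) _)
  (@NatTrans _ _ mapcyl_functor (tgt_functor _)
    (fun f => mapcyl_p (arr f)) _) _ _).
- by move=> f; apply: chain_map_eq => n x /=; rewrite addr0.
- by move=> f; apply: chain_map_eq => n y /=; rewrite linear0 add0r.
Unshelve.
- by move=> f g s; apply: chain_map_eq => n x /=; rewrite !linear0.
- by move=> f g s; apply: chain_map_eq => n x /=; rewrite !linear0.
- move=> f g s; apply: chain_map_eq => n x /=; rewrite linearD /=; congr (_ + _).
  exact: (esym (congr1 (fun h : chain_map _ _ => h n x.1.1) (sq_comm s))).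
Defined.

End MappingCylinder.

Section HConvergence.
Variable K : realType.

(* Sequences indexed by 1, 2, 3, ... are shifted to nat: the entry of index i *)
(* here is the one of index i + 1 in the usual numbering.                     *)
Definition cesaro_entry (i j : nat) : K := if (j <= i)%N then i.+1%:R^-1 else 0.

(* The matrix is lower triangular, so that row i is summed over j <= i. *)
Definition cesaro_mul (a : nat -> K) : nat -> K :=
  fun i => \sum_(j < i.+1) cesaro_entry i j * a j.

Definition H_convergent (a : nat -> K) : Prop :=
  exists2 k : nat, (0 < k)%N & cvgn (iter k cesaro_mul a).

Definition H_limit_is (a : nat -> K) (l : K) : Prop :=
  \forall k \near \oo, iter k cesaro_mul a @ \oo --> l.

Definition H_null (a : nat -> K) : Prop := H_convergent a /\ H_limit_is a 0.

Definition admissible (R : idomainType) (C : chain_complex R) : Prop :=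
  [/\ forall n, n < 0 -> forall x : C n, x = 0,
      forall n, fin_generated (homology C n),
      H_convergent (fun m => (-1) ^+ m * (mod_rank (homology C (m%:Z)))%:R) &
      H_null (fun m => m.+1%:R^-1 * (mod_rank (homology C (m%:Z)))%:R)].

Definition admissible_complexes (R : idomainType) : cwcategory :=
  @CWCategory (@full_subcategory (complex_category R) (@admissible R))
    (fun _ _ f => forall n, injective (cmap f n))
    (fun _ _ f => quasi_iso f).

End HConvergence.

(* Main.v *)
(** For a short exact sequence A -> E -> P of complexes let r_n be the rank of the
    kernel of H_n A -> H_n E. The long exact sequence gives
      rank H_n P + rank H_n A = rank H_n E + r_n + r_(n-1),
    so the partial sums of (-1)^n (rank H_n P + rank H_n A - rank H_n E) telescope
    to (-1)^n r_n, and the Cesaro means of this sequence are dominated by the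
    H-null sequence rank H_n A / (n + 1). Hence, when A is admissible, E is
    admissible if and only if P is. A pushout of B <- A -> D along an injective map
    is the cokernel of A -> B + D, hence admissible, and it is characterised by
    degreewise exactness; the gluing and extension axioms are then instances of
    the five lemma, a quasi-isomorphism being a map with acyclic mapping cone. *)
From HB Require Import structures.
From mathcomp Require Import all_boot all_order all_algebra reals.
From mathcomp Require Import boolp classical_sets topology normedtype sequences.
Require Import Defs.

Set Implicit Arguments.
Unset Strict Implicit.
Unset Printing Implicit Defensive.

Import Order.TTheory GRing.Theory Num.Theory numFieldNormedType.Exports.
Local Open Scope ring_scope.

(** * Subquotients: finite generation and rank *)

(** Ranks have to be added along the long exact sequence, whereas [mod_rank] is the dimension of a
    quotient of formal sums of tensors. Instead of showing that tensoring with the fraction field is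
    exact, ranks are computed from independent families with torsion cokernel, for subquotients Z /
    B given by two submodules of one module; the tensor product intervenes only once, where such a
    family is turned into a basis. Homology and the kernels and images of induced maps become sets
    of cycles modulo boundaries, and isomorphisms of subquotients are induced by linear relations,
    which accommodates the connecting homomorphism without choosing lifts. Noetherianity makes the
    kernel of H_n A -> H_n E finitely generated, so that r_n exists. The passage from E to P has one
    asymmetry: rank H_n P involves r_(n-1), hence A one degree lower, and H-nullity has to be shown
    to survive this shift. *)

Section OrdCat.
Variables (T : Type) (m n : nat) (g : 'I_m -> T) (h : 'I_n -> T).

Definition ocat (i : 'I_(m + n)) : T :=
  match split i with inl j => g j | inr j => h j end.

Lemma ocat_lshift i : ocat (lshift n i) = g i.
Proof. by rewrite /ocat (unsplitK (inl i)). Qed.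

Lemma ocat_rshift i : ocat (rshift m i) = h i.
Proof. by rewrite /ocat (unsplitK (inr i)). Qed.

Lemma ocatP (P : T -> Prop) :
  (forall i, P (g i)) -> (forall i, P (h i)) -> forall i, P (ocat i).
Proof. by move=> Pg Ph i; rewrite /ocat; case: split. Qed.

End OrdCat.

Lemma sum_ocat (R : pzRingType) (V : lmodType R) m n
    (c : 'I_(m + n) -> R) (g : 'I_m -> V) (h : 'I_n -> V) :
  \sum_i c i *: ocat g h i =
  \sum_i c (lshift n i) *: g i + \sum_i c (rshift m i) *: h i.
Proof.
rewrite big_split_ord; congr (_ + _); apply: eq_bigr => i _.
  by rewrite ocat_lshift.
by rewrite ocat_rshift.
Qed.

Lemma sum_ocat2 (R : pzRingType) (V : lmodType R) m n
    (c : 'I_m -> R) (d : 'I_n -> R) (g : 'I_m -> V) (h : 'I_n -> V) :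
  \sum_i ocat c d i *: ocat g h i = \sum_i c i *: g i + \sum_i d i *: h i.
Proof.
rewrite sum_ocat; congr (_ + _); apply: eq_bigr => i _.
  by rewrite ocat_lshift.
by rewrite ocat_rshift.
Qed.

Definition submodule (R : pzRingType) (V : lmodType R) (S : set V) : Prop :=
  S 0 /\ forall a x y, S x -> S y -> S (a *: x + y).

Section Submodule.
Variables (R : pzRingType) (V : lmodType R) (S : set V).
Hypothesis S_sub : submodule S.

Lemma submod0 : S 0. Proof. by case: S_sub. Qed.

Lemma submodD x y : S x -> S y -> S (x + y).
Proof. by move=> Sx Sy; rewrite -[x]scale1r; apply: S_sub.2. Qed.

Lemma submodZ a x : S x -> S (a *: x).
Proof. by move=> Sx; rewrite -[_ *: _]addr0; apply: S_sub.2 Sx submod0. Qed.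

Lemma submodN x : S x -> S (- x).
Proof. by rewrite -scaleN1r; apply: submodZ. Qed.

Lemma submodB x y : S x -> S y -> S (x - y).
Proof. by move=> Sx /submodN; apply: submodD. Qed.

Lemma submod_sum n (c : 'I_n -> R) (g : 'I_n -> V) :
  (forall i, S (g i)) -> S (\sum_i c i *: g i).
Proof.
by move=> Sg; elim/big_ind: _ => [|x y|i _];
  [exact: submod0|exact: submodD|exact: submodZ].
Qed.

Lemma submod_addr x y : S y -> S (x + y) <-> S x.
Proof.
move=> Sy; split=> [Sxy|Sx]; last exact: submodD.
by rewrite -(addrK y x); apply: submodB.
Qed.

Lemma submod_addl x y : S x -> S (x + y) <-> S y.
Proof. by rewrite addrC; apply: submod_addr. Qed.

End Submodule.

Lemma submodule0 (R : pzRingType) (V : lmodType R) : submodule [set (0 : V)].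
Proof. by split=> // a x y -> ->; rewrite scaler0 addr0. Qed.

(* For submodules B of Z, [sq_fg Z B] says that Z / B is finitely generated,  *)
(* and [sq_rank Z B n] that it contains n independent elements generating a   *)
(* submodule with torsion cokernel.                                           *)
Definition sq_fg (R : pzRingType) (V : lmodType R) (Z B : set V) : Prop :=
  exists (n : nat) (g : 'I_n -> V), (forall i, Z (g i)) /\
    forall z, Z z -> exists c : 'I_n -> R, B (z - \sum_i c i *: g i).

Definition sq_rank (R : pzRingType) (V : lmodType R) (Z B : set V) (n : nat) :
    Prop :=
  exists g : 'I_n -> V, [/\ forall i, Z (g i),
    forall c : 'I_n -> R, B (\sum_i c i *: g i) -> forall i, c i = 0 &
    forall z, Z z -> exists (r : R) (c : 'I_n -> R),
      r != 0 /\ B (r *: z - \sum_i c i *: g i)].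

Lemma sq_fg_refl (R : pzRingType) (V : lmodType R) (B : set V) : sq_fg B B.
Proof.
exists 0%N, (fun=> 0); split=> [[]//|z Bz].
by exists (fun=> 0); rewrite big_ord0 subr0.
Qed.

Lemma sq_rank_refl (R : nzRingType) (V : lmodType R) (B : set V) :
  sq_rank B B 0.
Proof.
exists (fun=> 0); split=> [[]//|c _ []//|z Bz].
by exists 1, (fun=> 0); rewrite big_ord0 subr0 scale1r oner_neq0.
Qed.

Section Correspondence.
Variables (R : idomainType) (V W : lmodType R) (rho : V -> W -> Prop).
Variables (ZV K BV : set V) (ZW BW : set W).

(* rho induces an isomorphism from ZV / K to ZW / BW. *)
Record correspondence : Prop := Correspondence {
  corr0 : rho 0 0;
  corrP : forall a v w v' w', rho v w -> rho v' w' ->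
    rho (a *: v + v') (a *: w + w');
  corrl : forall v, ZV v -> exists2 w, ZW w & rho v w;
  corrr : forall w, ZW w -> exists2 v, ZV v & rho v w;
  corrK : forall v w, ZV v -> ZW w -> rho v w -> K v <-> BW w
}.

Hypothesis C : correspondence.
Hypotheses (ZV_sub : submodule ZV) (K_sub : submodule K).
Hypotheses (ZW_sub : submodule ZW).
Hypotheses (KZ : forall v, K v -> ZV v) (BK : forall v, BV v -> K v).

Lemma corr_kernel v w : BW w -> ZV v -> ZW w -> rho v w -> K v.
Proof. by move=> Bw Zv Zw vw; apply/(corrK C Zv Zw vw). Qed.

Lemma corr_sum n (c : 'I_n -> R) (g : 'I_n -> V) (h : 'I_n -> W) :
  (forall i, rho (g i) (h i)) -> rho (\sum_i c i *: g i) (\sum_i c i *: h i).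
Proof.
move=> gh; elim/big_ind2: _ => [|v w v' w' vw vw'|i _]; first exact: corr0.
  by have := corrP C 1 vw vw'; rewrite !scale1r.
by have := corrP C (c i) (gh i) (corr0 C); rewrite !addr0.
Qed.

Lemma corr_lift n (h : 'I_n -> W) : (forall i, ZW (h i)) ->
  exists g : 'I_n -> V, (forall i, ZV (g i)) /\ forall i, rho (g i) (h i).
Proof.
move=> Zh; have /choice[g gP] : forall i, exists v, ZV v /\ rho v (h i).
  by move=> i; have [v] := corrr C (Zh i); exists v.
by exists g; split=> i; case: (gP i).
Qed.

(** Generators of K / BV are joined with lifts along [rho] of generators of ZW / BW: once the lifted
    combination is subtracted, the remainder lies in K. *)
Lemma corr_fg : sq_fg K BV -> sq_fg ZW BW -> sq_fg ZV BV.
Proof.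
move=> [m [g [Kg gP]]] [n [h [Zh hP]]].
have [v [Zv vP]] := corr_lift Zh.
exists (m + n)%N, (ocat g v); split=> [|z Zz].
  by apply: ocatP => // i; apply: KZ.
have [w Zw zw] := corrl C Zz; have [d Bd] := hP _ Zw.
have /gP[c Bc] : K (z - \sum_i d i *: v i).
  apply: (corr_kernel Bd).
  - by apply: submodB Zz _ => //; apply: submod_sum.
  - by apply: submodB Zw _ => //; apply: submod_sum.
  - rewrite ![_ - \sum_i _]addrC -!scaleN1r.
    by apply: corrP => //; apply: corr_sum.
by exists (ocat c d); rewrite sum_ocat2 [X in z - X]addrC opprD addrA.
Qed.

(** Independence is tested first in ZW / BW, which kills the coefficients of the lifts, then in K /
    BV. For the torsion condition, r brings a multiple of z into K up to lifts, and s then treats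
    the remainder. *)
Lemma corr_rank m n : submodule BV ->
  sq_rank K BV m -> sq_rank ZW BW n -> sq_rank ZV BV (m + n).
Proof.
move=> BV_sub [g [Kg gI gP]] [h [Zh hI hP]].
have [v [Zv vP]] := corr_lift Zh.
exists (ocat g v); split=> [|c|z Zz].
- by apply: ocatP => // i; apply: KZ.
- rewrite sum_ocat => Bc.
  have d0 : forall i, c (rshift m i) = 0.
    apply: hI; apply/(corrK C _ _ (corr_sum _ vP)); try exact: submod_sum.
    by move/BK: Bc => /(submod_addl K_sub); apply; apply: submod_sum.
  have c0 : forall i, c (lshift n i) = 0.
    apply: gI; move: Bc; rewrite [X in _ + X]big1 ?addr0// => i _.
    by rewrite d0 scale0r.
  by move=> i; rewrite -(splitK i); case: split.
- have [w Zw zw] := corrl C Zz; have [r [d [r0 Bd]]] := hP _ Zw.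
  have /gP[s [c [s0 Bc]]] : K (r *: z - \sum_i d i *: v i).
    apply: (corr_kernel Bd).
    + apply: submodB; [by []|exact: submodZ|by apply: submod_sum].
    + apply: submodB; [by []|exact: submodZ|by apply: submod_sum].
    + apply: corrP => //; rewrite -!scaleN1r -[_ *: \sum_i _]addr0.
      rewrite -[_ *: \sum_(i < n) _ *: h i]addr0; apply: corrP (corr0 C) => //.
      exact: corr_sum.
  exists (s * r), (ocat c (fun i => s * d i)); split; first exact: mulf_neq0.
  rewrite sum_ocat2 [X in _ - X]addrC opprD addrA -scalerA.
  under [X in _ - X - _]eq_bigr do rewrite -scalerA.
  by rewrite -scaler_sumr -scalerBr.
Qed.

End Correspondence.

(** Induction on the number of ambient generators, which need not lie in S. The coefficients at
    [v ord0] occurring in S form an ideal; finitely many elements of S realise its generators, and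
    subtracting a combination of them moves an element of S into the span of the other
    generators. *)
Lemma noetherian_sq_fg (R : comNzRingType) (V : lmodType R) n (v : 'I_n -> V)
    (S B : set V) :
  noetherian R -> submodule S -> submodule B ->
  (forall z, S z -> exists c : 'I_n -> R, B (z - \sum_i c i *: v i)) ->
  sq_fg S B.
Proof.
move=> hR S_sub B_sub; elim: n v S S_sub => [|n IHn] v S S_sub Sv.
  exists 0%N, v; split=> [[]//|z /Sv[c]]; rewrite big_ord0 => Bz.
  by exists c; rewrite big_ord0.
pose v' i := v (lift ord0 i).
pose I (r : R) := exists z (c : 'I_n -> R),
  S z /\ B (z - (r *: v ord0 + \sum_i c i *: v' i)).
have I_ideal : is_ideal I.
  have IP a x y : I x -> I y -> I (a * x + y).
    move=> [z [c [Sz Bz]]] [z' [c' [Sz' Bz']]].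
    exists (a *: z + z'), (fun i => a * c i + c' i); split.
      exact: S_sub.2.
    rewrite (_ : _ - _ = a *: (z - (x *: v ord0 + \sum_i c i *: v' i)) +
      (z' - (y *: v ord0 + \sum_i c' i *: v' i))); first exact: B_sub.2.
    under eq_bigr do rewrite scalerDl -scalerA.
    rewrite big_split /= -scaler_sumr scalerDl -scalerA addrACA -scalerDr.
    by rewrite opprD addrACA -scalerBr.
  have I0 : I 0.
    exists 0, (fun=> 0); split; first exact: submod0 S_sub.
    rewrite scale0r big1 ?addr0 ?subr0; first exact: submod0 B_sub.
    by move=> i _; rewrite scale0r.
  split=> // [x y Ix Iy|a x Ix]; first by rewrite -[x]mul1r; apply: IP.
  by rewrite -[_ * _]addr0; apply: IP.
have [k [r [Ir rP]]] := hR _ I_ideal.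
have /choice[z /choice[e zP]] := Ir.
pose S' y := S y /\ exists c : 'I_n -> R, B (y - \sum_i c i *: v' i).
have S'_sub : submodule S'.
  split=> [|a x y [Sx [c Bc]] [Sy [d Bd]]].
    split; first exact: submod0 S_sub.
    exists (fun=> 0); rewrite big1 ?subr0; first exact: submod0 B_sub.
    by move=> i _; rewrite scale0r.
  split; first exact: S_sub.2.
  exists (fun i => a * c i + d i).
  under eq_bigr do rewrite scalerDl -scalerA.
  by rewrite big_split /= -scaler_sumr opprD addrACA -scalerBr; apply: B_sub.2.
have [m [w [S'w wP]]] := IHn v' S' S'_sub (fun y S'y => S'y.2).
exists (k + m)%N, (ocat z w); split=> [|y Sy].
  by apply: ocatP => i; [case: (zP i)|case: (S'w i)].
have [c] := Sv _ Sy; rewrite big_ord_recl => By.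
have [a ca] : exists a : 'I_k -> R, c ord0 = \sum_i a i * r i.
  apply: rP; exists y, (fun i => c (lift ord0 i)); split=> //.
suff /wP[d Bd] : S' (y - \sum_i a i *: z i).
  by exists (ocat a d); rewrite sum_ocat2 opprD addrA.
split; first by apply: submodB => //; apply: submod_sum => // i; case: (zP i).
(* The coefficients of [y] at the remaining generators, minus those contributed by the [z j]. *)
exists (fun i => c (lift ord0 i) - \sum_j a j * e j i).
have Bz : B (\sum_j a j *: (z j - (r j *: v ord0 + \sum_i e j i *: v' i))).
  by apply: submod_sum => // j; case: (zP j).
have := submodB B_sub By Bz; congr B.
have -> : \sum_j a j *: (z j - (r j *: v ord0 + \sum_i e j i *: v' i)) =
    \sum_j a j *: z j -
    (c ord0 *: v ord0 + \sum_i (\sum_j a j * e j i) *: v' i).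
  rewrite ca scaler_suml.
  under [\sum_i _ *: v' i]eq_bigr do rewrite scaler_suml.
  rewrite exchange_big -big_split -sumrB; apply: eq_bigr => j _ /=.
  rewrite scalerBr scalerDr scalerA scaler_sumr; congr (_ - (_ + _)).
  by apply: eq_bigr => i _; rewrite scalerA.
under [\sum_i (_ - _) *: _]eq_bigr do rewrite scalerBl.
rewrite sumrB; move: (\sum_j a j *: _) (c ord0 *: _) => x1 x2.
rewrite !opprB opprD !addrA.
by rewrite [LHS](ACl (1*6*5*3*4*2)) /= addrK.
Qed.

Lemma sq_fg_sub (R : comNzRingType) (V : lmodType R) (Z S B : set V) :
  noetherian R -> submodule S -> submodule B -> (forall x, S x -> Z x) ->
  sq_fg Z B -> sq_fg S B.
Proof.
move=> hR S_sub B_sub SZ [n [g [_ gP]]].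
by apply: (noetherian_sq_fg (v := g)) => // z /SZ/gP.
Qed.

(** Generators are treated one at a time: [v ord0] joins the independent family unless a nonzero
    multiple of it already lies in the span modulo B. *)
Lemma sq_rank_exists (R : idomainType) (V : lmodType R) (Z B : set V) :
  submodule B -> sq_fg Z B -> exists n, sq_rank Z B n.
Proof.
move=> B_sub [n [v [Zv vP]]].
(* The torsion condition is restricted to the span of [v], because in the induction the tail of [v]
   no longer generates Z. *)
suff [m [g [Zg gI gP]]] : exists m (g : 'I_m -> V), [/\ forall i, Z (g i),
    forall c : 'I_m -> R, B (\sum_i c i *: g i) -> forall i, c i = 0 &
    forall z, (exists c : 'I_n -> R, B (z - \sum_i c i *: v i)) ->
      exists (r : R) (c : 'I_m -> R), r != 0 /\ B (r *: z - \sum_i c i *: g i)].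
  by exists m, g; split=> // z /vP; apply: gP.
elim: n v Zv {vP} => [|n IHn] v Zv.
  exists 0%N, (fun=> 0); split=> [[]//|c _ []//|z [c]].
  rewrite big_ord0 => Bz; exists 1, (fun=> 0).
  by rewrite scale1r big_ord0 oner_neq0.
have [|m [g [Zg gI gP]]] := IHn (fun i => v (lift ord0 i)); first by [].
have gP' z : (exists c : 'I_n.+1 -> R, B (z - \sum_i c i *: v i)) ->
    exists (a r : R) (c : 'I_m -> R),
      r != 0 /\ B (r *: z - (a *: v ord0 + \sum_i c i *: g i)).
  move=> [c]; rewrite big_ord_recl opprD addrA => Bz.
  have [|r [d [r0 Bd]]] := gP (z - c ord0 *: v ord0).
    by exists (fun i => c (lift ord0 i)).
  exists (r * c ord0), r, d; split=> //.
  by rewrite opprD addrA -scalerA -scalerBr.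
have [[r [c [r0 Bc]]]|nP] := pselect (exists (r : R) (c : 'I_m -> R),
    r != 0 /\ B (r *: v ord0 - \sum_i c i *: g i)).
  exists m, g; split=> // z /gP'[a [s [d [s0 Bd]]]].
  (* Adding r times the relation for [z] to a times the relation for [v ord0] eliminates
     [v ord0]. *)
  exists (r * s), (fun i => a * c i + r * d i); rewrite mulf_neq0//; split=> //.
  have := B_sub.2 r _ _ Bd (submodZ B_sub a Bc); congr B.
  under [in RHS]eq_bigr do rewrite scalerDl -!scalerA.
  rewrite big_split /= -!scaler_sumr -scalerA scalerBr scalerDr scalerBr.
  rewrite !scalerA [a * r]mulrC !opprD !addrA.
  by rewrite [LHS](ACl (1*5*3*4*2)) /= addrK.
exists (m + 1)%N, (ocat g (fun=> v ord0)); split.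
- exact: ocatP.
- move=> c; rewrite sum_ocat big_ord1 => Bc.
  have d0 : c (rshift m ord0) = 0.
    apply/eqP/negP => d0; apply: nP.
    exists (c (rshift m ord0)), (fun i => - c (lshift 1 i)).
    split; first exact/negP.
    under eq_bigr do rewrite scaleNr.
    by rewrite sumrN opprK addrC.
  move: Bc; rewrite d0 scale0r addr0 => /gI c0 i.
  by rewrite -(splitK i); case: split => j /=; rewrite ?c0 ?ord1.
- move=> z /gP'[a [r [c [r0 Bz]]]].
  exists r, (ocat c (fun=> a)); split=> //.
  by rewrite sum_ocat2 big_ord1 [_ + a *: _]addrC.
Qed.

Local Open Scope quotient_scope.

(** * Dimension of the tensor product with the field of fractions *)

Section BasisSize.
Variables (F : fieldType) (V : lmodType F).

(** The base change matrices satisfy [M *m N = 1%:M] by uniqueness of coordinates in [b], so M has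
    rank m, at most its number n of columns. *)
Lemma basis_leq m n (b : 'I_m -> V) (b' : 'I_n -> V) :
  is_basis b -> is_basis b' -> (m <= n)%N.
Proof.
move=> bB bB'.
have expand k (e : 'I_k -> V) (eB : is_basis e) l (w : 'I_l -> V) :
    exists M : 'M[F]_(l, k), forall i, w i = \sum_j M i j *: e j.
  have /choice[c cP] : forall i, exists c : {ffun 'I_k -> F},
      w i = \sum_j c j *: e j.
    by move=> i; have [c [cE _]] := eB (w i); exists c.
  by exists (\matrix_(i, j) c i j) => i; under eq_bigr do rewrite mxE.
have [M ME] := expand _ _ bB' _ b; have [N NE] := expand _ _ bB _ b'.
suff MN : M *m N = 1%:M.
  by rewrite -(mxrank1 F m) -MN (leq_trans (mxrankM_maxl M N))// rank_leq_col.
have bE i (c : 'I_m -> F) : b i = \sum_j c j *: b j ->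
    forall j, c j = (i == j)%:R.
  have [e [_ eU]] := bB (b i) => bc j.
  suff /ffunP/(_ j) : [ffun k => c k] = [ffun k => (i == k)%:R : F].
    by rewrite !ffunE.
  apply: (etrans (esym (eU _ _)) (eU _ _)).
    by rewrite [LHS]bc; apply: eq_bigr => k _; rewrite ffunE.
  rewrite (bigD1 i)//= ffunE eqxx scale1r big1 ?addr0// => k ki.
  by rewrite ffunE eq_sym (negPf ki) scale0r.
apply/matrixP => i j; rewrite [RHS]mxE; apply: (bE i (fun j => (M *m N) i j)).
rewrite [LHS]ME; under eq_bigr do rewrite NE scaler_sumr.
rewrite exchange_big; apply: eq_bigr => k _; rewrite mxE scaler_suml.
by apply: eq_bigr => l _; rewrite scalerA.
Qed.

Lemma dim_basis n (b : 'I_n -> V) : is_basis b -> Defs.dim V = n.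
Proof.
move=> bB; apply: xget_unique => [|m [b' bB']]; first by exists b.
by apply/eqP; rewrite eqn_leq !(basis_leq bB bB', basis_leq bB' bB).
Qed.

End BasisSize.

Section TensorRank.
Variables (R : idomainType) (A : lmodType R).
Local Notation Q := {fraction R}.
Local Notation "x %:F" := (FracField.tofrac x) (format "x %:F").
Implicit Types (s t : seq (A * Q)).

Lemma fracP (q : Q) : exists n d : R, d != 0 /\ d%:F * q = n%:F.
Proof.
elim/quotW: q => x; exists (frac x).1, (frac x).2.
have x0 := denom_ratioP x; split=> //; unlock FracField.tofrac.
rewrite -[LHS]FracField.pi_mul /FracField.mulf !numden_Ratio ?oner_neq0// mul1r.
apply/eqmodP; rewrite /= FracField.equivfE.
by rewrite !numden_Ratio ?mulf_neq0 ?oner_neq0// mulr1.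
Qed.

(* r clears all denominators of the formal sum s, and multiplying s by r      *)
(* gives the image of x in the tensor product.                                *)
Fixpoint cleared (r : R) s (x : A) : Prop :=
  if s is (a, q) :: s' then
    exists c y, [/\ c%:F = r%:F * q, cleared r s' y & x = c *: a + y]
  else x = 0.

Lemma cleared_fun r s x y : cleared r s x -> cleared r s y -> x = y.
Proof.
elim: s x y => [|[a q] s IHs] x y /=; first by move=> -> ->.
move=> [c [z [cE /IHs sz ->]]] [d [w [dE /sz <- ->]]].
by congr (_ *: _ + _); apply/eqP; rewrite -tofrac_eq cE dE.
Qed.

Lemma cleared_scale k r s x : cleared r s x -> cleared (k * r) s (k *: x).
Proof.
elim: s x => [|[a q] s IHs] x /=; first by move=> ->; rewrite scaler0.
move=> [c [y [cE /IHs sy ->]]]; exists (k * c), (k *: y).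
by rewrite !tofracM cE mulrA scalerDr scalerA.
Qed.

Lemma cleared_cat r s t x : cleared r (s ++ t) x <->
  exists y z, [/\ cleared r s y, cleared r t z & x = y + z].
Proof.
elim: s x => [|[a q] s IHs] x /=.
  split=> [tx|[y [z [-> tz ->]]]]; last by rewrite add0r.
  by exists 0, x; rewrite add0r.
split=> [[c [u [cE /IHs[y [z [sy tz ->]]] ->]]]|].
  exists (c *: a + y), z; rewrite addrA; split=> //.
  by exists c, y.
move=> [_ [z [[c [y [cE sy ->]]] tz ->]]]; exists c, (y + z).
rewrite addrA; split=> //; apply/IHs.
by exists y, z.
Qed.

Lemma cleared_exists s : exists r x, r != 0 /\ cleared r s x.
Proof.
elim: s => [|[a q] s [r [x [r0 sx]]]]; first by exists 1, 0; rewrite oner_neq0.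
have [n [d [d0 nE]]] := fracP q.
exists (d * r), (r * n *: a + d *: x); rewrite mulf_neq0//; split=> //.
exists (r * n), (d *: x); split=> //; last exact: cleared_scale.
by rewrite !tofracM -nE mulrCA mulrA.
Qed.

(** This detects vanishing in the tensor product without constructing the localisation of A: a
    formal sum congruent to the empty one is cleared to 0 by some nonzero r. Each generator of the
    congruence only needs a common denominator. *)
Lemma tensor_rel_cleared s t : tensor_rel s t ->
  exists r x, [/\ r != 0, cleared r s x & cleared r t x].
Proof.
elim=> {s t}.
- by move=> s; have [r [x [r0 sx]]] := cleared_exists s; exists r, x.
- by move=> s t _ [r [x [r0 sx tx]]]; exists r, x.
- move=> s t u _ [r [x [r0 sx tx]]] _ [k [y [k0 ty uy]]].
  exists (k * r), (k *: x); rewrite mulf_neq0//; split=> //.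
    exact: cleared_scale.
  (* Both sides are the value of the middle sum [t] cleared by k * r. *)
  have -> : k *: x = r *: y.
    apply: (cleared_fun (cleared_scale k tx)).
    by rewrite mulrC; apply: cleared_scale.
  by rewrite mulrC; apply: cleared_scale.
- move=> s s' t t' _ [r [x [r0 sx s'x]]] _ [k [y [k0 ty t'y]]].
  exists (k * r), (k *: x + r *: y); rewrite mulf_neq0//.
  split=> //; apply/cleared_cat; exists (k *: x), (r *: y); split=> //;
    by [apply: cleared_scale|rewrite mulrC; apply: cleared_scale].
- move=> s t; have [r [x [r0 sx]]] := cleared_exists (s ++ t).
  exists r, x; split=> //; apply/cleared_cat.
  have /cleared_cat[y [z [sy tz ->]]] := sx.
  by exists z, y; rewrite addrC.
- move=> q.
  have [r [x [r0 [c [y [cE y0 xE]]]]]] := cleared_exists [:: (0 : A, q)].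
  exists r, x; split=> //; first by exists c, y.
  by rewrite /= xE y0 scaler0 addr0.
- move=> a b q; have [n [d [d0 nE]]] := fracP q.
  exists d, (n *: (a + b)); split=> //=.
    by exists n, 0; rewrite addr0.
  exists n, (n *: b); rewrite scalerDr; split=> //.
  by exists n, 0; rewrite addr0.
- move=> a p q; have [n [d [d0 nE]]] := fracP p.
  have [m [e [e0 mE]]] := fracP q.
  exists (d * e), ((e * n + d * m) *: a); rewrite mulf_neq0//; split=> //=.
    exists (e * n + d * m), 0; rewrite addr0; split=> //.
    rewrite tofracD !tofracM -nE -mE mulrDr; congr (_ + _); rewrite ?mulrA//.
    by rewrite [e%:F * _]mulrC.
  exists (e * n), (d * m *: a); rewrite scalerDl; split=> //.
    by rewrite !tofracM -nE mulrA [e%:F * _]mulrC.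
  by exists (d * m), 0; rewrite addr0 !tofracM -mE mulrA.
- move=> k a q; have [n [d [d0 nE]]] := fracP q.
  exists d, (n *: (k *: a)); split=> //=.
    by exists n, 0; rewrite addr0.
  exists (n * k), 0; rewrite addr0 scalerA; split=> //.
  by rewrite tofracM -nE -mulrA [q * _]mulrC.
Qed.

Lemma tensor_cons a q s : \pi_(tensor_frac A) ((a, q) :: s) =
  q *: \pi_(tensor_frac A) [:: (a, 1)] + \pi_(tensor_frac A) s.
Proof.
rewrite -cat1s [LHS]pi_tensorD; congr (_ + _).
by rewrite -[RHS]pi_tensorZ /= mulr1.
Qed.

Lemma tensor_sum (I : Type) (r : seq I) (c : I -> Q) (g : I -> A) :
  \pi_(tensor_frac A) [seq (g i, c i) | i <- r] =
  \sum_(i <- r) c i *: \pi_(tensor_frac A) [:: (g i, 1)].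
Proof.
elim: r => [|i r IHr]; first by rewrite big_nil.
by rewrite big_cons -IHr -tensor_cons.
Qed.

Lemma tensor1_sum n (c : 'I_n -> R) (g : 'I_n -> A) :
  \pi_(tensor_frac A) [:: (\sum_i c i *: g i, 1)] =
  \sum_i (c i)%:F *: \pi_(tensor_frac A) [:: (g i, 1)].
Proof.
apply: (big_ind2 (fun x y => \pi_(tensor_frac A) [:: (x, 1)] = y)).
- exact/tensor_eqP/tensor0l.
- move=> x _ y _ <- <-; rewrite -[RHS]pi_tensorD.
  exact/tensor_eqP/tensorDl.
- move=> i _; rewrite -[RHS]pi_tensorZ.
  exact/tensor_eqP/tensor_balanced.
Qed.

Lemma tensor_basis n (g : 'I_n -> A) :
  (forall c : 'I_n -> R, \sum_i c i *: g i = 0 -> forall i, c i = 0) ->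
  (forall a, exists (r : R) (c : 'I_n -> R),
    r != 0 /\ r *: a = \sum_i c i *: g i) ->
  is_basis (fun i => \pi_(tensor_frac A) [:: (g i, 1)]).
Proof.
move=> gI gP.
have indep (c : 'I_n -> Q) :
    \sum_i c i *: \pi_(tensor_frac A) [:: (g i, 1)] = 0 -> forall i, c i = 0.
  rewrite -tensor_sum => /tensor_eqP/tensor_rel_cleared[r [x [r0 cx x0]]].
  rewrite /= in x0; rewrite {x}x0 in cx.
  have [d [dE d0]] : exists d : 'I_n -> R,
      (forall i, (d i)%:F = r%:F * c i) /\ 0 = \sum_i d i *: g i.
    (* [cleared] supplies one numerator per list entry; the membership premise lets the choice for a
       fixed i go through by induction on the list. *)
    have dE i : exists d : R, i \in index_enum 'I_n -> d%:F = r%:F * c i.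
      elim: index_enum (0 : A) cx => [|j s IHs] x /=; first by exists 0.
      move=> [d [y [dE /IHs[e eE] _]]].
      have [->|ij] := eqVneq i j; first by exists d.
      by exists e; rewrite inE (negPf ij).
    have [d {}dE] := choice dE; exists d.
    have {}dE i : (d i)%:F = r%:F * c i by apply: dE; rewrite mem_index_enum.
    split=> //; apply: cleared_fun cx _.
    elim: index_enum => [|j s IHs]; first by rewrite big_nil.
    by rewrite big_cons /=; exists (d j), (\sum_(i <- s) d i *: g i).
  move=> i; have /eqP := dE i; rewrite gI// tofrac0 eq_sym mulf_eq0 tofrac_eq0.
  by rewrite (negPf r0) => /eqP.
have span v : exists c : {ffun 'I_n -> Q},
    v = \sum_i c i *: \pi_(tensor_frac A) [:: (g i, 1)].
  elim/quotW: v => s; elim: s => [|[a q] s [c cE]].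
    exists [ffun=> 0]; rewrite big1// => i _; by rewrite ffunE scale0r.
  have [r [d [r0 dE]]] := gP a.
  (* As r a is the sum of the d i times g i, the tensor of a and q is q / r times the sum of the d i
     times the tensors of g i and 1. *)
  exists [ffun i => q / r%:F * (d i)%:F + c i].
  under eq_bigr do rewrite ffunE scalerDl -scalerA.
  rewrite big_split /= -cE tensor_cons; congr (_ + _).
  have r0F : r%:F != 0 by rewrite tofrac_eq0.
  rewrite -scaler_sumr -tensor1_sum -dE -{1}(mulfVK r0F q) -scalerA.
  congr (_ *: _); rewrite -[LHS]pi_tensorZ.
  by apply/tensor_eqP/tensor_sym/tensor_balanced.
move=> v; have [c cE] := span v; exists c; split=> // c' cE'.
apply/ffunP => i; apply/eqP; rewrite -subr_eq0; apply/eqP.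
apply: (indep (fun i => c i - c' i)).
under eq_bigr do rewrite scalerBl.
by rewrite sumrB -cE -cE' subrr.
Qed.

End TensorRank.

(** * Homology of complexes *)

Lemma fin_generatedE (R : comNzRingType) (A : lmodType R) :
  fin_generated A <-> sq_fg [set: A] [set 0].
Proof.
split=> [[n [g gP]]|[n [g [_ gP]]]]; exists n, g.
  by split=> // x _; have [c cE] := gP x; exists c; rewrite cE /= subrr.
by move=> x; have [//|c /subr0_eq] := gP x; exists c.
Qed.

Lemma mod_rankE (R : idomainType) (A : lmodType R) n :
  sq_rank [set: A] [set 0] n -> mod_rank A = n.
Proof.
move=> [g [_ gI gP]]; apply: dim_basis (tensor_basis gI _) => a.
by have [//|r [c [r0 /subr0_eq]]] := gP a; exists r, c.
Qed.

(** Since BV lies in K, images under [rho] of generators of ZV / BV generate ZV / K, which is ZW /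
    BW. *)
Lemma corr_fg_image (R : idomainType) (V W : lmodType R) (rho : V -> W -> Prop)
    (ZV K BV : set V) (ZW BW : set W) :
  correspondence rho ZV K ZW BW -> submodule ZV -> submodule ZW ->
  (forall v, BV v -> K v) -> sq_fg ZV BV -> sq_fg ZW BW.
Proof.
move=> C ZV_sub ZW_sub BK [n [g [Zg gP]]].
have /choice[h hP] : forall i, exists w, ZW w /\ rho (g i) w.
  by move=> i; have [w] := corrl C (Zg i); exists w.
have Zh i : ZW (h i) by case: (hP i).
exists n, h; split=> // w Zw; have [v Zv vw] := corrr C Zw.
have [c /BK Kc] := gP _ Zv; exists c.
have Zv' : ZV (v - \sum_i c i *: g i).
  by apply: submodB Zv _ => //; apply: submod_sum.
have Zw' : ZW (w - \sum_i c i *: h i).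
  by apply: submodB Zw _ => //; apply: submod_sum.
have vw' : rho (v - \sum_i c i *: g i) (w - \sum_i c i *: h i).
  rewrite ![_ - \sum_i _]addrC -!scaleN1r.
  by apply: (corrP C) => //; apply: (corr_sum C) => i; case: (hP i).
exact/(corrK C Zv' Zw' vw').
Qed.

Section Boundary.
Variables (R : pzRingType) (C : chain_complex R).

Definition cyc n : set (C n) := [set x | bd C n x = 0].
Definition bnd n : set (C n) := [set x | boundary x].
Arguments cyc n : clear implicits.
Arguments bnd n : clear implicits.

(** Differentials land in degrees written n - 1; putting an arbitrary degree in this form replaces
    casts between degrees. *)
Lemma int_pred_ind (P : int -> Prop) : (forall n, P (n - 1)) -> forall n, P n.
Proof. by move=> PP n; rewrite -(addrK 1 n). Qed.

Lemma boundary_predP n (x : C (n - 1)) :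
  boundary x <-> exists y : C n, x = bd C n y.
Proof.
split=> [|[y ->]]; last exact: Boundary.
(* To invert the indexed family [boundary], its degree must be a variable tied to n - 1 by an
   equation; the equation then identifies the degrees and, by uniqueness of identity proofs, the
   cast disappears. *)
suff H m (z : C m) : boundary z -> forall e : m = n - 1,
    exists y : C n, ecast i (C i) e z = bd C n y by move=> /H/(_ erefl).
case=> {z} k y e; have kn := addIr _ e; move: y e; rewrite kn => y e.
by exists y; rewrite eq_axiomK.
Qed.

Lemma bnd_sub n : submodule (bnd n).
Proof.
elim/int_pred_ind: n => n; split=> [|a x y].
  by apply/boundary_predP; exists 0; rewrite linear0.
move=> /boundary_predP[x' ->] /boundary_predP[y' ->].
by apply/boundary_predP; exists (a *: x' + y'); rewrite linearP.
Qed.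

Lemma cyc_sub n : submodule (cyc n).
Proof.
split=> [|a x y]; first exact: linear0.
by rewrite /cyc /= linearP => -> ->; rewrite scaler0 addr0.
Qed.

Lemma bnd_cyc n x : bnd n x -> cyc n x.
Proof. by case=> m y; exact: bdK. Qed.

Lemma bnd0 n : bnd n 0. Proof. exact: submod0 (bnd_sub n). Qed.

End Boundary.
Arguments cyc {R} C n.
Arguments bnd {R} C n.

Section HomologyClass.
Variables (R : pzRingType) (C : chain_complex R) (n : int).

Lemma homology_eqP (z w : cycles C n) :
  \pi_(homology C n) z = \pi_(homology C n) w <-> boundary (val z - val w).
Proof.
split=> [/quotmod_eqP|zw]; first by rewrite unfold_in => /asboolP.
by apply/quotmod_eqP; rewrite unfold_in; apply/asboolP.
Qed.

Lemma pi_homologyP a (z w : cycles C n) :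
  \pi_(homology C n) (a *: z + w) =
  a *: \pi_(homology C n) z + \pi_(homology C n) w.
Proof. by rewrite raddfD /=; congr (_ + _); exact: pi_quotmodZ. Qed.

Definition cycle_of (x : C n) (xZ : cyc C n x) : cycles C n :=
  exist _ x (introT eqP xZ).

Lemma cycle_ofP (z : cycles C n) : cyc C n (val z).
Proof. exact/eqP/(valP z). Qed.

End HomologyClass.

Lemma inj_surj_bij (T U : Type) (f : T -> U) :
  injective f -> (forall y, exists x, f x = y) -> bijective f.
Proof. by move=> fI /choice[g gK]; exists g => // x; apply: fI. Qed.

Section QuasiIso.
Variables (R : pzRingType) (C D : chain_complex R) (f : chain_map C D).

Lemma boundary_map n (x : C n) : boundary x -> boundary (f n x).
Proof. by case=> m y; rewrite -cmap_bd; exact: Boundary. Qed.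

Lemma cyc_map n (x : C n) : cyc C n x -> cyc D n (f n x).
Proof. by rewrite /cyc /= cmap_bd => ->; rewrite linear0. Qed.

(* A cycle of the cone is, up to sign, a pair (x, y) with dx = 0, f x = dy.   *)
Definition acyclic_cone : Prop :=
  forall n (x : C (n - 1)) (y : D n),
    cyc C (n - 1) x -> f (n - 1) x = bd D n y ->
    exists x' : C n, x = bd C n x' /\ boundary (y - f n x').

Lemma acyclic_cone_inj : acyclic_cone ->
  forall n (x : C n), cyc C n x -> boundary (f n x) -> boundary x.
Proof.
move=> F; elim/int_pred_ind => n x Zx.
move=> /boundary_predP[y /(F _ _ _ Zx)[x' [-> _]]].
exact: Boundary.
Qed.

Lemma acyclic_cone_surj : acyclic_cone ->
  forall n (y : D n), cyc D n y -> exists2 x, cyc C n x & boundary (y - f n x).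
Proof.
move=> F n y Zy; have [||x [x0 yx]] := F n 0 y; first exact: linear0.
  by rewrite Zy linear0.
by exists x.
Qed.

(** In the cone condition, x = 0 gives surjectivity on homology, and a primitive y of f x gives
    injectivity. Conversely, injectivity provides a primitive of x, which surjectivity corrects by a
    cycle. Diagram chases can thus use elements rather than classes. *)
Lemma quasi_isoP : quasi_iso f <-> acyclic_cone.
Proof.
split=> [F n x y Zx fx|F n].
  have inj m (z : C m) : cyc C m z -> boundary (f m z) -> boundary z.
    move=> Zz bz; suff /homology_eqP : \pi_(homology C m) (cycle_of Zz) =
        \pi_(homology C m) 0 by rewrite /= subr0.
    apply: (bij_inj (F m)); rewrite !pi_homology_map.
    by apply/homology_eqP; rewrite /= linear0 subr0.
  have [x0 x0E] : exists x0 : C n, x = bd C n x0.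
    by apply/boundary_predP/inj => //; rewrite fx; exact: Boundary.
  have Zy : cyc D n (y - f n x0).
    by rewrite /cyc /= linearB /= cmap_bd -x0E fx subrr.
  have [g _ gK] := F n.
  set h := g (\pi_(homology D n) (cycle_of Zy)).
  have := gK (\pi_(homology D n) (cycle_of Zy)); rewrite -/h -[h]reprK.
  rewrite pi_homology_map => /esym/homology_eqP /= bE.
  exists (x0 + val (repr h)); split.
    by rewrite linearD /= (cycle_ofP (repr h)) addr0.
  by rewrite linearD opprD addrA.
apply: inj_surj_bij.
  move=> h k; rewrite -[h]reprK -[k]reprK !pi_homology_map.
  move=> /homology_eqP /=; rewrite -linearB => bE; apply/homology_eqP.
  apply: (acyclic_cone_inj F) bE.
  apply: (submodB (cyc_sub C n)); exact: cycle_ofP.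
move=> h; have [x Zx bx] := acyclic_cone_surj F (cycle_ofP (repr h)).
exists (\pi_(homology C n) (cycle_of Zx)).
by rewrite pi_homology_map -[h]reprK; apply/esym/homology_eqP.
Qed.

End QuasiIso.

(** * Short exact sequences and the five lemma *)

Record short_exact (R : pzRingType) (A E P : chain_complex R)
    (i : chain_map A E) (p : chain_map E P) : Prop := ShortExact {
  ses_inj : forall n, injective (i n);
  ses_comp : forall n a, p n (i n a) = 0;
  ses_exact : forall n e, p n e = 0 -> exists a, e = i n a;
  ses_surj : forall n y, exists e, y = p n e
}.

Section FiveLemma.
Variables (R : pzRingType) (A E P A' E' P' : chain_complex R).
Variables (i : chain_map A E) (p : chain_map E P).
Variables (i' : chain_map A' E') (p' : chain_map E' P').
Variables (a : chain_map A A') (e : chain_map E E') (h : chain_map P P').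
Hypotheses (S : short_exact i p) (S' : short_exact i' p').
Hypotheses (ai : forall n x, e n (i n x) = i' n (a n x)).
Hypotheses (ep : forall n x, h n (p n x) = p' n (e n x)).

(** A lift (u, v) of a cone cycle of [h] fails to be a cone cycle of [e] by a cone cycle (w, t) of
    [a]. Acyclicity there yields (s, r), and (u - i s, v + i' r) is the corrected lift. *)
Lemma five_quotient : acyclic_cone a -> acyclic_cone e -> acyclic_cone h.
Proof.
move=> aA eA n x y Zx hx.
have [u xE] := ses_surj S x; have [v yE] := ses_surj S' y; subst x y.
have [w wE] : exists w, bd E (n - 1) u = i _ w.
  by apply: (ses_exact S); rewrite -cmap_bd.
have Zw : cyc A _ w.
  by apply: (ses_inj S); rewrite -cmap_bd -wE bdK linear0.
have [t tE] : exists t, e _ u - bd E' n v = i' _ t.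
  by apply: (ses_exact S'); rewrite linearB /= -ep hx cmap_bd subrr.
have [|s [sE /boundary_predP[r rE]]] := aA _ w t Zw.
  apply: (ses_inj S'); rewrite -ai -wE -[RHS]cmap_bd -tE linearB /= bdK subr0.
  exact: esym (cmap_bd _ _).
have [||z [zE bz]] := eA n (u - i _ s) (v + i' _ r).
- by rewrite /cyc /= linearB /= wE cmap_bd sE subrr.
- rewrite linearB linearD /= ai cmap_bd -rE linearB /= -tE.
  by rewrite addrA [_ + (e _ u - _)]addrC subrK.
exists (p _ z); rewrite cmap_bd -zE linearB /= (ses_comp S) subr0; split=> //.
have := boundary_map p' bz.
by rewrite linearB linearD /= (ses_comp S') addr0 ep.
Qed.

Lemma lift_boundary n (y : P' n) : boundary y ->
  exists2 x : E' n, boundary x & y = p' n x.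
Proof.
case=> m z; have [x ->] := ses_surj S' z; exists (bd E' m x).
  exact: Boundary.
by rewrite cmap_bd.
Qed.

(** The solution z for [h] lifts to u. The errors x - d u and, up to the boundary v, y - e u come
    from a cone cycle (w, t) of [a], whose solution s corrects u to u + i s. *)
Lemma five_middle : acyclic_cone a -> acyclic_cone h -> acyclic_cone e.
Proof.
move=> aA hA n x y Zx ex.
have [||z [zE bz]] := hA n (p _ x) (p' _ y); first exact: cyc_map.
  by rewrite ep ex cmap_bd.
have [u uE] := ses_surj S z; subst z.
have [w wE] : exists w, x - bd E n u = i _ w.
  by apply: (ses_exact S); rewrite linearB /= zE cmap_bd subrr.
have Zw : cyc A _ w.
  apply: (ses_inj S); rewrite -cmap_bd -wE linearB /= bdK subr0 linear0.
  exact: Zx.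
have [v bv vE] := lift_boundary bz.
have [t tE] : exists t, y - e _ u - v = i' _ t.
  by apply: (ses_exact S'); rewrite !linearB /= -ep -vE subrr.
have [|s [sE bs]] := aA n w t Zw.
  apply: (ses_inj S'); rewrite -ai -wE -cmap_bd -tE !linearB /= cmap_bd ex.
  by rewrite (bnd_cyc bv) subr0.
exists (u + i _ s); split.
  by rewrite linearD /= cmap_bd -sE -wE addrCA subrr addr0.
rewrite linearD /= ai opprD addrA -(subrK v (y - e n u)) tE addrAC -linearB.
by apply: (submodD (bnd_sub E' n)) bv; apply: boundary_map.
Qed.

End FiveLemma.

Section HomologyRank.
Variables (R : idomainType) (C : chain_complex R).

(** Transports finite generation and rank from the quotient type to cycles modulo boundaries inside
    [C n], where kernels and images can be compared. *)
Lemma homology_corr n : correspondence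
  (fun (x : homology C n) (z : C n) =>
     exists2 u : cycles C n, z = val u & x = \pi_(homology C n) u)
  setT [set 0] (cyc C n) (bnd C n).
Proof.
have pi0 : \pi_(homology C n) 0 = 0 by rewrite raddf0.
split.
- by exists 0 => //; rewrite pi0.
- move=> a _ _ _ _ [u -> ->] [u' -> ->]; exists (a *: u + u') => //.
  by rewrite pi_homologyP.
- move=> x _; exists (val (repr x)); first exact: cycle_ofP.
  by exists (repr x); rewrite ?reprK.
- move=> z Zz; exists (\pi_(homology C n) (cycle_of Zz)) => //.
  by exists (cycle_of Zz).
- move=> x z _ _ [u -> ->]; rewrite -pi0 /= -[X in bnd C n X]subr0.
  exact: homology_eqP.
Qed.

Let sub0 n : submodule [set (0 : homology C n)] := submodule0 _.

Lemma homology_fgP n :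
  fin_generated (homology C n) <-> sq_fg (cyc C n) (bnd C n).
Proof.
split=> [/fin_generatedE|] fg.
  by apply: (corr_fg_image (homology_corr n)) fg => //; exact: cyc_sub.
apply/fin_generatedE.
by apply: (corr_fg (homology_corr n)) (sq_fg_refl _) fg => //; exact: cyc_sub.
Qed.

Lemma homology_rank n k : sq_rank (cyc C n) (bnd C n) k ->
  mod_rank (homology C n) = k.
Proof.
move=> Ck; apply: mod_rankE; rewrite -[k]add0n.
apply: (corr_rank (homology_corr n)) (sq_rank_refl _) Ck => //.
exact: cyc_sub.
Qed.

Lemma homology_rankP n : fin_generated (homology C n) ->
  sq_rank (cyc C n) (bnd C n) (mod_rank (homology C n)).
Proof.
move=> /homology_fgP/(sq_rank_exists (bnd_sub C n))[k Ck].
by rewrite (homology_rank Ck).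
Qed.

End HomologyRank.

(** * The long exact homology sequence *)

Section ImageKernel.
Variables (R : idomainType) (A E : chain_complex R) (i : chain_map A E).

(* The cycles representing classes in the kernel, resp. the image, of H_n(i). *)
Definition hker n : set (A n) := [set a | cyc A n a /\ boundary (i n a)].
Definition him n : set (E n) :=
  [set e | exists a, cyc A n a /\ boundary (e - i n a)].

Arguments hker n : clear implicits.
Arguments him n : clear implicits.

Lemma hker_sub n : submodule (hker n).
Proof.
split=> [|a x y [Zx bx] [Zy biy]].
  by split; [exact: (submod0 (cyc_sub A n))|rewrite linear0; exact: bnd0].
split; first exact: (cyc_sub A n).2.
by rewrite linearP; apply: (bnd_sub E n).2.
Qed.

Lemma him_sub n : submodule (him n).
Proof.
split=> [|a x y [x' [Zx bx]] [y' [Zy biy]]].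
  exists 0; split; first exact: (submod0 (cyc_sub A n)).
  by rewrite linear0 subr0; exact: bnd0.
exists (a *: x' + y'); split; first exact: (cyc_sub A n).2.
rewrite linearP opprD addrACA -scalerBr.
exact: (bnd_sub E n).2.
Qed.

Lemma bnd_hker n a : bnd A n a -> hker n a.
Proof. by move=> ba; split; [exact: bnd_cyc|exact: boundary_map]. Qed.

Lemma bnd_him n e : bnd E n e -> him n e.
Proof.
move=> be; exists 0; split; first exact: (submod0 (cyc_sub A n)).
by rewrite linear0 subr0.
Qed.

Lemma him_cyc n e : him n e -> cyc E n e.
Proof.
move=> [a [Za ba]]; rewrite -(subrK (i n a) e).
by apply: (submodD (cyc_sub E n) (bnd_cyc ba) (cyc_map _ Za)).
Qed.

Lemma him_corr n : correspondence (fun a e => boundary (e - i n a))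
  (cyc A n) (hker n) (him n) (bnd E n).
Proof.
have bP a (x y : E n) : boundary x -> boundary y -> boundary (a *: x + y).
  exact: (bnd_sub E n).2.
split.
- by rewrite linear0 subr0; exact: bnd0.
- move=> a v w v' w' bv bv'.
  by rewrite linearP opprD addrACA -scalerBr; apply: bP.
- move=> a Za; exists (i n a); last by rewrite subrr; exact: bnd0.
  by exists a; rewrite subrr; split=> //; exact: bnd0.
- by move=> e [a [Za ba]]; exists a.
- move=> a e Za _ bea; split=> [[_ ba]|be].
    by rewrite -(subrK (i n a) e); apply: (submodD (bnd_sub E n) bea ba).
  split=> //; rewrite -(subKr e (i n a)).
  exact: (submodB (bnd_sub E n) be bea).
Qed.

End ImageKernel.
Arguments hker {R A E} i n.
Arguments him {R A E} i n.

Section LongExact.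
Variables (R : idomainType) (A E P : chain_complex R).
Variables (i : chain_map A E) (p : chain_map E P).
Hypothesis S : short_exact i p.

(** A boundary [p n e] lifts to a boundary of E; subtracting it from [e] leaves an element coming
    from A. This is exactness at H_n E. *)
Lemma hker_him n e : hker p n e <-> him i n e.
Proof.
split=> [[Ze /(lift_boundary S)[x bx]]|[a [Za ba]]].
  move=> /eqP; rewrite -subr_eq0 -linearB => /eqP/(ses_exact S)[a aE].
  exists a; rewrite -aE opprB addrC subrK; split=> //.
  apply: (ses_inj S); rewrite -cmap_bd -aE !linearB /= (bnd_cyc bx) Ze.
  by rewrite subrr linear0.
split; first by apply: (@him_cyc _ _ _ i); exists a.
by have := boundary_map p ba; rewrite linearB /= (ses_comp S) subr0.
Qed.

(** The snake construction: y lifts to e, and d e descends to a. Its kernel [him p n] and its image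
    [hker i (n - 1)] express exactness at H_n P and at H_(n-1) A. *)
Lemma connecting_corr n : correspondence
  (fun y a => exists2 e, y = p n e & i (n - 1) a = bd E n e)
  (cyc P n) (him p n) (hker i (n - 1)) (bnd A (n - 1)).
Proof.
split.
- by exists 0; rewrite !linear0.
- move=> k _ a _ a' [e -> ia] [e' -> ia']; exists (k *: e + e').
    by rewrite linearP.
  by rewrite !linearP /= ia ia'.
- move=> y Zy; have [e ye] := ses_surj S y; subst y.
  have [a aE] : exists a, bd E n e = i _ a.
    by apply: (ses_exact S); rewrite -cmap_bd.
  exists a; last by exists e.
  split; last by rewrite -aE; exact: Boundary.
  by apply: (ses_inj S); rewrite -cmap_bd -aE bdK linear0.
- move=> a [Za /boundary_predP[e eE]]; exists (p n e); last by exists e.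
  by rewrite /cyc /= cmap_bd -eE (ses_comp S).
- move=> _ a _ _ [e -> ia]; split=> [[e' [Ze']]|/boundary_predP[b aE]].
    rewrite -linearB => /(lift_boundary S)[x bx] /eqP.
    rewrite -subr_eq0 -linearB => /eqP/(ses_exact S)[b bE].
    apply/boundary_predP; exists b; apply: (ses_inj S).
    by rewrite ia -cmap_bd -bE !linearB /= Ze' (bnd_cyc bx) !subr0.
  exists (e - i n b); split.
    by rewrite /cyc /= linearB /= -ia aE cmap_bd subrr.
  by rewrite linearB /= (ses_comp S) subr0 subrr; exact: bnd0.
Qed.

Definition homology_fg (C : chain_complex R) :=
  forall n, fin_generated (homology C n).

Hypothesis hR : noetherian R.

(** H_n P is an extension of the kernel of H_(n-1) A -> H_(n-1) E, a submodule of a finitely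
    generated module, by the image of H_n E. *)
Lemma homology_fg_quotient : homology_fg A -> homology_fg E -> homology_fg P.
Proof.
move=> fgA fgE n; apply/homology_fgP.
apply: (corr_fg (connecting_corr n)); try exact: cyc_sub; try exact: hker_sub.
- exact: him_cyc.
- apply: (corr_fg_image (@him_corr _ _ _ p n)).
  + exact: cyc_sub.
  + exact: him_sub.
  + exact: bnd_hker.
  + exact/homology_fgP.
- apply: (sq_fg_sub (Z := cyc A (n - 1))) => //.
  + exact: hker_sub.
  + exact: bnd_sub.
  + by move=> x [].
  + exact/homology_fgP.
Qed.

Lemma him_fg n : homology_fg A -> sq_fg (him i n) (bnd E n).
Proof.
move=> fgA; apply: (corr_fg_image (@him_corr _ _ _ i n)).
- exact: cyc_sub.
- exact: him_sub.
- exact: bnd_hker.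
- exact/homology_fgP.
Qed.

Lemma hker_himE n : hker p n = him i n.
Proof. by apply/seteqP; split=> e /hker_him. Qed.

Lemma homology_fg_middle : homology_fg A -> homology_fg P -> homology_fg E.
Proof.
move=> fgA fgP n; apply/homology_fgP.
apply: (corr_fg (@him_corr _ _ _ p n)).
- exact: cyc_sub.
- exact: him_sub.
- by move=> x [].
- by rewrite hker_himE; apply: him_fg.
- apply: (sq_fg_sub (Z := cyc P n)) => //.
  + exact: him_sub.
  + exact: bnd_sub.
  + exact: him_cyc.
  + exact/homology_fgP.
Qed.

Local Notation b C n := (mod_rank (homology C n)).

(* r n is the rank of the kernel of H_n(i), the image of the connecting       *)
(* homomorphism.                                                              *)
Lemma homology_rank_exact : homology_fg A -> homology_fg E -> homology_fg P ->
  exists r : int -> nat, forall n,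
    (r n <= b A n)%N /\ (b P n + b A n = b E n + r n + r (n - 1)%R)%N.
Proof.
move=> fgA fgE fgP.
have /choice[r rP] : forall n, exists r, sq_rank (hker i n) (bnd A n) r.
  move=> n; apply: sq_rank_exists; first exact: bnd_sub.
  apply: (sq_fg_sub (Z := cyc A n)) => //.
  - exact: hker_sub.
  - exact: bnd_sub.
  - by move=> x [].
  - exact/homology_fgP.
exists r => n.
(* With k and l the ranks of the images of H_n(i) and H_n(p), the ranks of H_n A, H_n E and H_n P
   split as r n + k, k + l and l + r (n - 1). *)
have [k kP] := sq_rank_exists (bnd_sub E n) (him_fg n fgA).
have bA : (b A n = r n + k)%N.
  apply: homology_rank; apply: (corr_rank (@him_corr _ _ _ i n)) (rP n) kP.
  - exact: cyc_sub.
  - exact: hker_sub.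
  - exact: him_sub.
  - by move=> x [].
  - exact: bnd_hker.
  - exact: bnd_sub.
have [l lP] : exists l, sq_rank (him p n) (bnd P n) l.
  apply: sq_rank_exists; first exact: bnd_sub.
  apply: (sq_fg_sub (Z := cyc P n)) => //.
  - exact: him_sub.
  - exact: bnd_sub.
  - exact: him_cyc.
  - exact/homology_fgP.
have bE : (b E n = k + l)%N.
  rewrite -hker_himE in kP.
  apply: homology_rank; apply: (corr_rank (@him_corr _ _ _ p n)) kP lP.
  - exact: cyc_sub.
  - exact: hker_sub.
  - exact: him_sub.
  - by move=> x [].
  - exact: bnd_hker.
  - exact: bnd_sub.
have bP : (b P n = l + r (n - 1)%R)%N.
  apply: homology_rank.
  apply: (corr_rank (connecting_corr n)) lP (rP (n - 1)).
  - exact: cyc_sub.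
  - exact: him_sub.
  - exact: hker_sub.
  - exact: him_cyc.
  - exact: bnd_him.
  - exact: bnd_sub.
rewrite bA bE bP leq_addr; split=> //.
by rewrite [LHS](AC (2*2) (4*1*3*2)).
Qed.

End LongExact.

Section QuasiIsoRank.
Variables (R : idomainType) (C D : chain_complex R) (f : chain_map C D).
Hypothesis F : acyclic_cone f.

Lemma quasi_iso_corr n : correspondence (fun x y => boundary (y - f n x))
  (cyc C n) (bnd C n) (cyc D n) (bnd D n).
Proof.
case: (him_corr f n) => c0 cP cl _ cK; split=> //.
- by move=> x Zx; have [y /him_cyc] := cl x Zx; exists y.
- by move=> y Zy; have [x] := acyclic_cone_surj F Zy; exists x.
- move=> x y Zx Zy xy; rewrite -(cK x y)//; last by exists x.
  split=> [|[_ bx]]; first exact: bnd_hker.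
  exact: acyclic_cone_inj bx.
Qed.

Lemma quasi_iso_fg : homology_fg D -> homology_fg C.
Proof.
move=> fgD n; apply/homology_fgP.
apply: (corr_fg (quasi_iso_corr n)).
- exact: cyc_sub.
- exact: cyc_sub.
- by move=> x; apply: bnd_cyc.
- exact: sq_fg_refl.
- exact/homology_fgP.
Qed.

Lemma quasi_iso_rank n : homology_fg D ->
  mod_rank (homology C n) = mod_rank (homology D n).
Proof.
move=> fgD; apply: homology_rank; rewrite -[mod_rank _]add0n.
apply: (corr_rank (quasi_iso_corr n)) (sq_rank_refl _) (homology_rankP (fgD n)).
- exact: cyc_sub.
- exact: bnd_sub.
- exact: cyc_sub.
- by move=> x; apply: bnd_cyc.
- by [].
- exact: bnd_sub.
Qed.

End QuasiIsoRank.

(** * H-convergence *)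

Section HSequences.
Local Open Scope classical_set_scope.
Variable K : realType.
Local Notation M := (@cesaro_mul K).
Implicit Types a b x : nat -> K.

Lemma cesaro_mulE a n : M a n = n.+1%:R^-1 * \sum_(j < n.+1) a j.
Proof.
rewrite mulr_sumr; apply: eq_bigr => j _.
by rewrite /cesaro_entry -ltnS ltn_ord.
Qed.

Lemma iter_cesaroD k a b :
  iter k M (fun n => a n + b n) = fun n => iter k M a n + iter k M b n.
Proof.
elim: k => // k IHk; rewrite !iterS IHk; apply/funext => n.
rewrite -big_split; apply: eq_bigr => j _ /=.
by rewrite mulrDr.
Qed.

Lemma iter_cesaroN k a : iter k M (fun n => - a n) = fun n => - iter k M a n.
Proof.
elim: k => // k IHk; rewrite !iterS IHk; apply/funext => n.
by rewrite -sumrN; apply: eq_bigr => j _; rewrite mulrN.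
Qed.

Lemma iter_cesaro_le k a b : (forall n, a n <= b n) ->
  forall n, iter k M a n <= iter k M b n.
Proof.
move=> ab; elim: k => // k IHk n; rewrite !iterS !cesaro_mulE.
by rewrite ler_pM2l ?invr_gt0 ?ltr0n// ler_sum.
Qed.

Lemma cesaro_cvg a (l : K) : a @ \oo --> l -> M a @ \oo --> l.
Proof.
move=> /cesaro; congr (_ @ \oo --> l); apply/funext => n.
by rewrite cesaro_mulE /arithmetic_mean /= seriesEord.
Qed.

Lemma iter_cesaro_cvg k m a (l : K) : (k <= m)%N ->
  iter k M a @ \oo --> l -> iter m M a @ \oo --> l.
Proof.
move=> /subnK <-; elim: (m - k)%N => // d IHd /IHd.
by rewrite addSn iterS; apply: cesaro_cvg.
Qed.

(** Limits persist under further averaging, by Cesaro's theorem, so a witness k can be raised to the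
    positive [k.+1]. *)
Lemma H_convergentP a :
  H_convergent a <-> exists k (l : K), iter k M a @ \oo --> l.
Proof.
split=> [[k _ ca]|[k [l al]]]; first by exists k, (limn (iter k M a)).
by exists k.+1 => //; apply/cvg_ex; exists l; apply: iter_cesaro_cvg al.
Qed.

Lemma H_nullP a : H_null a <-> exists k, iter k M a @ \oo --> (0 : K).
Proof.
split=> [[_ [k _ kP]]|[k ak]]; first by exists k; apply: kP => /=.
split; first by apply/H_convergentP; exists k, 0.
by exists k => // m /=; move=> km; apply: iter_cesaro_cvg ak.
Qed.

Lemma H_convergentD a b : H_convergent a -> H_convergent b ->
  H_convergent (fun n => a n + b n).
Proof.
move=> /H_convergentP[k [l al]] /H_convergentP[m [l' bl]].
apply/H_convergentP; exists (maxn k m), (l + l'); rewrite iter_cesaroD.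
by apply: cvgD; [apply: iter_cesaro_cvg al|apply: iter_cesaro_cvg bl];
  rewrite leq_max leqnn ?orbT.
Qed.

Lemma H_convergentN a : H_convergent a -> H_convergent (fun n => - a n).
Proof.
move=> /H_convergentP[k [l al]].
by apply/H_convergentP; exists k, (- l); rewrite iter_cesaroN; apply: cvgN.
Qed.

Lemma H_nullD a b : H_null a -> H_null b -> H_null (fun n => a n + b n).
Proof.
move=> /H_nullP[k ak] /H_nullP[m bm]; apply/H_nullP; exists (maxn k m).
rewrite iter_cesaroD -[X in _ --> X]addr0.
by apply: cvgD; [apply: iter_cesaro_cvg ak|apply: iter_cesaro_cvg bm];
  rewrite leq_max leqnn ?orbT.
Qed.

(** The iterates of M are monotone and commute with negation, so those of [a] are squeezed between
    those of -b and b. *)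
Lemma H_null_dominated a b : (forall n, `|a n| <= b n) -> H_null b -> H_null a.
Proof.
move=> ab /H_nullP[k bk]; apply/H_nullP; exists k.
apply: (@squeeze_cvgr _ _ _ _ (fun n => - iter k M b n) (iter k M b)) => //.
  apply: nearW => n.
  have <- : iter k M (fun n => - b n) n = - iter k M b n.
    by rewrite iter_cesaroN.
  by apply/andP; split; apply: iter_cesaro_le => m;
    have := ab m; rewrite ler_norml => /andP[].
by rewrite -oppr0; apply: cvgN.
Qed.

Lemma H_null_cesaro x : H_null (M x) -> H_null x.
Proof.
by move=> /H_nullP[k]; rewrite -iterSr => xk; apply/H_nullP; exists k.+1.
Qed.

(** Shifting does not commute with averaging, but as x 0 = 0 and a is nonnegative, the partial sums
    of x are bounded by those of a. Hence M x <= M a, and it suffices that M x be H-null. *)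
Lemma H_null_shift a x : (forall n, 0 <= x n) -> x 0%N = 0 ->
  (forall n, x n.+1 <= a n) -> H_null a -> H_null x.
Proof.
move=> x0 x00 xa /H_nullP[k ak]; apply: H_null_cesaro.
apply: (@H_null_dominated _ (M a)) => [n|]; last first.
  by apply/H_nullP; exists k; rewrite -iterSr iterS; apply: cesaro_cvg.
have Mx : M x n <= M a n.
  rewrite !cesaro_mulE ler_pM2l ?invr_gt0 ?ltr0n//.
  rewrite big_ord_recl x00 add0r big_ord_recr /= -[X in X <= _]addr0.
  by apply: lerD; [apply: ler_sum|apply: le_trans (xa n)].
rewrite ger0_norm// cesaro_mulE mulr_ge0 ?invr_ge0 ?ler0n//.
exact: sumr_ge0.
Qed.

Lemma H_convergent0 : H_convergent (fun=> 0 : K).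
Proof. by apply/H_convergentP; exists 0%N, 0; apply: cvg_cst. Qed.

Lemma H_null0 : H_null (fun=> 0 : K).
Proof. by apply/H_nullP; exists 0%N; apply: cvg_cst. Qed.

Definition admissible_ranks (b : nat -> nat) : Prop :=
  H_convergent (fun n => (-1) ^+ n * (b n)%:R : K) /\
  H_null (fun n => n.+1%:R^-1 * (b n)%:R : K).

Section RankExact.
Variables (a e p r : nat -> nat).
Hypotheses (ra : forall n, (r n <= a n)%N).
Hypotheses (r0 : (p 0 + a 0 = e 0 + r 0)%N).
Hypotheses (rS : forall n, (p n.+1 + a n.+1 = e n.+1 + r n.+1 + r n)%N).
Hypothesis adm_a : admissible_ranks a.

Let x n : K := (-1) ^+ n * ((p n)%:R + (a n)%:R - (e n)%:R).

(* The partial sums of x telescope to the ranks of the connecting maps. *)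
Let sum_x n : \sum_(j < n.+1) x j = (-1) ^+ n * (r n)%:R.
Proof.
elim: n => [|n IHn]; rewrite big_ord_recr /=.
  by rewrite big_ord0 add0r /x -natrD r0 natrD addrAC subrr add0r.
rewrite IHn /x -natrD rS !natrD [_ - _]addrC !addrA addNr add0r mulrDr addrCA.
by rewrite exprS mulN1r !mulNr subrr addr0.
Qed.

Let x_null : H_null x.
Proof.
apply: H_null_cesaro; apply: H_null_dominated adm_a.2 => n.
rewrite cesaro_mulE sum_x normrM ger0_norm ?invr_ge0 ?ler0n//.
rewrite ler_pM2l ?invr_gt0 ?ltr0n// normrM normrX normrN1 expr1n mul1r.
by rewrite normr_nat ler_nat.
Qed.

Lemma admissible_ranks_quotient : admissible_ranks e -> admissible_ranks p.
Proof.
move=> [ce ne]; split.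
  have := H_convergentD (H_convergentD ce (H_convergentN adm_a.1)) x_null.1.
  congr H_convergent; apply/funext => n.
  rewrite /x -mulrBr -mulrDr; congr (_ * _).
  by rewrite addrC addrA subrK addrK.
(* The exact sequence gives p n <= e n + r (n - 1), with r (-1) read as 0. The last term is bounded
   by a shift of the H-null sequence of A: r m / (m + 2) <= a m / (m + 1). *)
pose s n : K := if n is m.+1 then n.+1%:R^-1 * (r m)%:R else 0.
have ns : H_null s.
  apply: (H_null_shift (a := fun n => n.+1%:R^-1 * (a n)%:R)) adm_a.2 => //.
    by case=> //= n; rewrite mulr_ge0 ?invr_ge0.
  move=> n /=; apply: ler_pM; rewrite ?invr_ge0 ?ler_nat//.
  by rewrite lef_pV2 ?posrE ?ltr0n// ler_nat.
apply: H_null_dominated (H_nullD ne ns) => n.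
rewrite ger0_norm ?mulr_ge0 ?invr_ge0//; case: n => [|n] /=.
  rewrite addr0 ler_pM2l ?invr_gt0// ler_nat -(leq_add2r (a 0%N)) r0.
  by rewrite leq_add2l.
rewrite -mulrDr ler_pM2l ?invr_gt0// -natrD ler_nat -(leq_add2r (a n.+1)) rS.
by rewrite addnAC leq_add2l.
Qed.

Lemma admissible_ranks_middle : admissible_ranks p -> admissible_ranks e.
Proof.
move=> [cp np]; split.
  have := H_convergentD (H_convergentD cp adm_a.1) (H_convergentN x_null.1).
  congr H_convergent; apply/funext => n.
  by rewrite /x -mulrDr -mulrBr subKr.
apply: H_null_dominated (H_nullD np adm_a.2) => n.
rewrite ger0_norm ?mulr_ge0 ?invr_ge0// -mulrDr ler_pM2l ?invr_gt0// -natrD.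
by rewrite ler_nat; case: n => [|n]; rewrite ?r0 ?rS -?addnA leq_addr.
Qed.

End RankExact.

End HSequences.

(** * Constructions on complexes *)

Section ChainMaps.
Variable R : pzRingType.
Implicit Types A B C D E P : chain_complex R.

Definition zero_complex : chain_complex R :=
  @ChainComplex R (fun=> 'rV[R]_0) (fun=> \0) (fun _ _ => erefl).

Definition zero_map C D : chain_map C D.
Proof.
refine (@ChainMap R C D (fun _ _ => 0) _ _).
- by move=> n a x y; rewrite scaler0 addr0.
- by move=> n x; rewrite linear0.
Defined.

Section DirectSum.
Variables C D : chain_complex R.

Definition dsum_ob n : lmodType R := (C n * D n)%type.
Definition dsum_bd n (t : dsum_ob n) : dsum_ob (n - 1) :=
  (bd C n t.1, bd D n t.2).

Lemma dsum_bd_linear n : linear (@dsum_bd n).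
Proof. by move=> a x y; rewrite /dsum_bd !linearP. Qed.
HB.instance Definition _ n := GRing.isLinear.Build R (dsum_ob n)
  (dsum_ob (n - 1)) *:%R (@dsum_bd n) (@dsum_bd_linear n).

Lemma dsum_bdK n x : @dsum_bd (n - 1) (@dsum_bd n x) = 0.
Proof. by rewrite /dsum_bd /= !bdK. Qed.

Definition dsum : chain_complex R :=
  @ChainComplex R dsum_ob (fun n => @dsum_bd n) dsum_bdK.

Definition dsum_in1 : chain_map C dsum.
Proof.
refine (@ChainMap R C dsum (fun n x => (x, 0)) _ _).
- by move=> n a x y; congr (_, _) => /=; rewrite scaler0 addr0.
- by move=> n x; rewrite /= /dsum_bd /= linear0.
Defined.

Definition dsum_in2 : chain_map D dsum.
Proof.
refine (@ChainMap R D dsum (fun n y => (0, y)) _ _).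
- by move=> n a x y; congr (_, _) => /=; rewrite scaler0 addr0.
- by move=> n x; rewrite /= /dsum_bd /= linear0.
Defined.

Definition dsum_out2 : chain_map dsum D.
Proof. by refine (@ChainMap R dsum D (fun n t => t.2) _ _). Defined.

Variables (E : chain_complex R) (f : chain_map C E) (g : chain_map D E).

Definition dsum_copair : chain_map dsum E.
Proof.
refine (@ChainMap R dsum E (fun n t => f n t.1 + g n t.2) _ _).
- by move=> n a x y; rewrite /= !linearP scalerDr addrACA.
- by move=> n x; rewrite linearD /= !cmap_bd.
Defined.

End DirectSum.

(* The minus sign makes the composite with [dsum_copair u v] vanish whenever  *)
(* u f = v g.                                                                 *)
Definition dsum_pair A C D (f : chain_map A C) (g : chain_map A D) :
  chain_map A (dsum C D).
Proof.
refine (@ChainMap R A (dsum C D) (fun n x => (f n x, - g n x)) _ _).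
- by move=> n a x y; congr (_, _); rewrite /= linearP// opprD scalerN.
- by move=> n x; rewrite /= /dsum_bd /= linearN /= !cmap_bd.
Defined.

Section Cokernel.
Variables (A E : chain_complex R) (k : chain_map A E).

Definition im_pred n : {pred E n} := fun y => `[< exists x, y = k n x >].

Lemma im_pred_submod n : submod_closed (@im_pred n).
Proof.
split=> [|a x y]; rewrite !unfold_in.
  by apply/asboolP; exists 0; rewrite linear0.
move=> /asboolP[x' ->] /asboolP[y' ->].
by apply/asboolP; exists (a *: x' + y'); rewrite linearP.
Qed.

Local Notation cok n := (quotmod (@im_pred_submod n)).

Lemma cok_eqP n (x y : E n) :
  \pi_(cok n) x = \pi_(cok n) y <-> exists a, x - y = k n a.
Proof.
split=> [/quotmod_eqP|xy]; first by rewrite unfold_in => /asboolP.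
by apply/quotmod_eqP; rewrite unfold_in; apply/asboolP.
Qed.

Lemma pi_cokP n a (x y : E n) :
  \pi_(cok n) (a *: x + y) = a *: \pi_(cok n) x + \pi_(cok n) y.
Proof. by rewrite raddfD /=; congr (_ + _); exact: pi_quotmodZ. Qed.

Definition coker_bd n (x : cok n) : cok (n - 1) :=
  \pi_(cok (n - 1)) (bd E n (repr x)).

Lemma coker_bd_pi n x : coker_bd (\pi_(cok n) x) = \pi_(cok (n - 1)) (bd E n x).
Proof.
apply/cok_eqP; have [a aE] := (cok_eqP (repr (\pi_(cok n) x)) x).1 (reprK _).
by exists (bd A n a); rewrite -linearB aE cmap_bd.
Qed.

Lemma coker_bd_linear n : linear (@coker_bd n).
Proof.
move=> a x y; rewrite -[x]reprK -[y]reprK -pi_cokP !coker_bd_pi -pi_cokP.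
by rewrite linearP.
Qed.
HB.instance Definition _ n := GRing.isLinear.Build R (cok n) (cok (n - 1)) *:%R
  (@coker_bd n) (@coker_bd_linear n).

Lemma coker_bdK n x : @coker_bd (n - 1) (@coker_bd n x) = 0.
Proof. by rewrite -[x]reprK !coker_bd_pi bdK raddf0. Qed.

Definition coker : chain_complex R :=
  @ChainComplex R (fun n => cok n) (fun n => @coker_bd n) coker_bdK.

Definition coker_proj : chain_map E coker.
Proof.
refine (@ChainMap R E coker (fun n x => \pi_(cok n) x) _ _).
- by move=> n a x y; rewrite pi_cokP.
- by move=> n x; rewrite /= coker_bd_pi.
Defined.

Lemma coker_short_exact : (forall n, injective (k n)) ->
  short_exact k coker_proj.
Proof.
move=> kI; have pi0 n : \pi_(cok n) 0 = 0 by rewrite raddf0.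
split=> // [n a|n e|n y].
- by rewrite /= -pi0; apply/cok_eqP; exists a; rewrite subr0.
- by rewrite /= -pi0 => /cok_eqP[a]; rewrite subr0; exists a.
- by exists (repr y); rewrite /= reprK.
Qed.

End Cokernel.

Lemma dsum_short_exact C D : short_exact (dsum_in1 C D) (dsum_out2 C D).
Proof.
split=> // [n x y [] //|n [x y] /= -> |n y]; first by exists x.
by exists (0, y).
Qed.

End ChainMaps.

Section Admissible.
Variables (K : realType) (R : idomainType).
Implicit Types A C D E P : chain_complex R.

Lemma admissibleP C : admissible K C <->
  [/\ forall n, n < 0 -> forall x : C n, x = 0, homology_fg C &
      admissible_ranks K (fun m => mod_rank (homology C m%:Z))].
Proof. by split=> [[? ? ? ?]|[? ? [? ?]]]; split. Qed.

Lemma trivial_homology_fg C : (forall n (x : C n), x = 0) -> homology_fg C.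
Proof.
move=> C0 n; apply/homology_fgP; exists 0%N, (fun=> 0); split=> [[]//|z _].
by exists (fun=> 0); rewrite big_ord0 subr0 (C0 n z); exact: bnd0.
Qed.

Lemma trivial_mod_rank C n : (forall x : C n, x = 0) ->
  mod_rank (homology C n) = 0%N.
Proof.
move=> C0; apply: homology_rank; exists (fun=> 0); split=> [[]//|c _ []//|z _].
exists 1, (fun=> 0); rewrite big_ord0 subr0 (C0 (1 *: z)) oner_neq0.
by split=> //; exact: bnd0.
Qed.

Lemma trivial_admissible C : (forall n (x : C n), x = 0) -> admissible K C.
Proof.
move=> C0; apply/admissibleP; split; first by move=> n _; exact: C0.
  exact: trivial_homology_fg.
rewrite (_ : (fun m => _) = fun=> 0%N); last first.
  by apply/funext => m; apply: trivial_mod_rank; exact: C0.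
rewrite /admissible_ranks; split.
  by under eq_fun do rewrite mulr0; exact: H_convergent0.
by under eq_fun do rewrite mulr0; exact: H_null0.
Qed.

Section ShortExact.
Variables (A E P : chain_complex R) (i : chain_map A E) (p : chain_map E P).
Hypotheses (S : short_exact i p) (hR : noetherian R) (admA : admissible K A).

Let rank_exact : homology_fg E -> homology_fg P -> exists r : nat -> nat,
  [/\ forall m, (r m <= mod_rank (homology A m%:Z))%N,
      (mod_rank (homology P 0%:Z) + mod_rank (homology A 0%:Z) =
       mod_rank (homology E 0%:Z) + r 0)%N &
      forall m, (mod_rank (homology P m.+1%:Z) + mod_rank (homology A m.+1%:Z) =
       mod_rank (homology E m.+1%:Z) + r m.+1 + r m)%N].
Proof.
have [A0 fgA _ _] := admA.
move=> fgE fgP; have [r rP] := homology_rank_exact S hR fgA fgE fgP.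
exists (fun m => r m%:Z); split.
- by move=> m; case: (rP m%:Z).
(* r (-1) is at most the rank of H_(-1) A, which is 0 because A vanishes in negative degrees; this
   starts the telescoping sum. *)
- have [_ ->] := rP 0; suff -> : r (0 - 1) = 0%N by rewrite addn0.
  have [+ _] := rP (0 - 1); rewrite trivial_mod_rank ?leqn0; first by move/eqP.
  exact: A0.
- move=> m; have [_ ->] := rP m.+1%:Z; congr (_ + r _)%N.
  by rewrite -addn1 PoszD addrK.
Qed.

Lemma admissible_quotient : admissible K E -> admissible K P.
Proof.
move=> admE; have [_ fgA _ _] := admA; have [E0 fgE _ _] := admE.
have fgP := homology_fg_quotient S hR fgA fgE.
apply/admissibleP; split=> // [n n0 y|].
  by have [e ->] := ses_surj S y; rewrite (E0 n n0 e) linear0.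
have [r [ra r0 rS]] := rank_exact fgE fgP.
by case/admissibleP: admA => _ _ aA; case/admissibleP: admE => _ _;
  exact: admissible_ranks_quotient ra r0 rS aA.
Qed.

Lemma admissible_middle : admissible K P -> admissible K E.
Proof.
move=> admP; have [A0 fgA _ _] := admA; have [P0 fgP _ _] := admP.
have fgE := homology_fg_middle S hR fgA fgP.
apply/admissibleP; split=> // [n n0 y|].
  have [a ->] := ses_exact S (P0 n n0 (p n y)).
  by rewrite (A0 n n0 a) linear0.
have [r [ra r0 rS]] := rank_exact fgE fgP.
by case/admissibleP: admA => _ _ aA; case/admissibleP: admP => _ _;
  exact: admissible_ranks_middle ra r0 rS aA.
Qed.

End ShortExact.

Lemma admissible_dsum C D : noetherian R ->
  admissible K C -> admissible K D -> admissible K (dsum C D).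
Proof. by move=> hR; exact: admissible_middle (dsum_short_exact C D) hR. Qed.

Lemma admissible_quasi_iso C D (f : chain_map C D) :
  (forall n, n < 0 -> forall x : C n, x = 0) -> quasi_iso f ->
  admissible K D -> admissible K C.
Proof.
move=> C0 /quasi_isoP F /admissibleP[_ fgD rD]; apply/admissibleP.
split=> //; first exact: quasi_iso_fg F fgD.
by congr admissible_ranks : rD; apply/funext => m; rewrite (quasi_iso_rank F).
Qed.

End Admissible.

(** * Pushouts *)

Local Open Scope cat_scope.

Section Pushouts.
Variable C : category.

Lemma pushout_iso (A B D P P' : C) (f : hom A B) (g : hom A D)
    (u : hom B P) (v : hom D P) (u' : hom B P') (v' : hom D P') :
  is_pushout f g u v -> is_pushout f g u' v' ->
  exists h : hom P P', [/\ is_iso h, h \oc u = u' & h \oc v = v'].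
Proof.
move=> [uv uvU] [uv' uvU'].
have [h [[hu hv] _]] := uvU _ _ _ uv'; have [k [[ku kv] _]] := uvU' _ _ _ uv.
exists h; split=> //; exists k; split.
  have [l [_ lU]] := uvU _ _ _ uv.
  rewrite -(lU (idm P)) ?comp1f//; apply/esym/lU.
  by rewrite -!compA hu hv ku kv.
have [l [_ lU]] := uvU' _ _ _ uv'.
rewrite -(lU (idm P')) ?comp1f//; apply/esym/lU.
by rewrite -!compA ku kv hu hv.
Qed.

Section ArrowPushouts.
Variables (A B D P : arrow_category C) (f : hom A B) (g : hom A D).
Variables (u : hom B P) (v : hom D P).

Lemma arrow_pushout :
  is_pushout (sq_src f) (sq_src g) (sq_src u) (sq_src v) ->
  is_pushout (sq_tgt f) (sq_tgt g) (sq_tgt u) (sq_tgt v) ->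
  is_pushout f g u v.
Proof.
move=> [s sU] [t tU]; split=> [|X x y xy]; first exact: square_eq.
have xys := congr1 (@sq_src _ _ _) xy; have xyt := congr1 (@sq_tgt _ _ _) xy.
have [h [[hu hv] hU]] := sU _ _ _ xys; have [k [[ku kv] kU]] := tU _ _ _ xyt.
(* Both composites leave the source pushout and agree on its two legs, so uniqueness there makes the
   induced square commute. *)
have hk : k \oc arr P = arr X \oc h.
  have e : sq_tgt x \oc arr B \oc sq_src f = sq_tgt y \oc arr D \oc sq_src g.
    by rewrite -!compA -!sq_comm !compA [sq_tgt x \oc _]xyt.
  have [l [_ lU]] := sU _ _ _ e.
  rewrite -(lU (k \oc arr P)).
    apply: lU; rewrite -!compA hu hv; split; exact/esym/sq_comm.
  by rewrite -!compA -!sq_comm !compA ku kv.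
exists (Square hk); split.
  by split; apply: square_eq.
move=> l [lu lv]; apply: square_eq => /=.
  by apply: hU; rewrite -lu -lv.
by apply: kU; rewrite -lu -lv.
Qed.

(* tgt is left adjoint to X |-> id_X *)
Lemma arrow_pushout_tgt : is_pushout f g u v ->
  is_pushout (sq_tgt f) (sq_tgt g) (sq_tgt u) (sq_tgt v).
Proof.
move=> [uv uvU]; split=> [|X x y xy]; first exact: (congr1 (@sq_tgt _ _ _) uv).
have sqP E (z : hom (tgt E) X) :
    z \oc arr E = arr (Arrow (idm X)) \oc (z \oc arr E).
  by rewrite /= comp1f.
pose sq E z : @hom (arrow_category C) E (Arrow (idm X)) :=
  @Square C E (Arrow (idm X)) (z \oc arr E) z (sqP E z).
have sq_inj E (s : @hom (arrow_category C) E (Arrow (idm X))) :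
    s = sq E (sq_tgt s).
  apply: square_eq => //=; rewrite -[LHS]comp1f; exact: (esym (sq_comm s)).
have e : sq B x \oc f = sq D y \oc g.
  by rewrite [LHS]sq_inj [RHS]sq_inj; congr sq.
have [h [[hu hv] hU]] := uvU _ _ _ e.
exists (sq_tgt h); split.
  by rewrite -[x]/(sq_tgt (sq B x)) -hu -[y]/(sq_tgt (sq D y)) -hv.
move=> k [ku kv]; rewrite (hU (sq P k))//.
by split; rewrite [LHS]sq_inj; congr sq.
Qed.

(* src is left adjoint to X |-> (X -> 0) *)
Lemma arrow_pushout_src : (exists Z : C, is_zero Z) -> is_pushout f g u v ->
  is_pushout (sq_src f) (sq_src g) (sq_src u) (sq_src v).
Proof.
move=> [Z [_ Z1]] [uv uvU]; split=> [|X x y xy].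
  exact: (congr1 (@sq_src _ _ _) uv).
have Zeq (E : C) (s t : hom E Z) : s = t.
  by have [z [_ zU]] := Z1 E; rewrite -(zU s)// -(zU t).
have Zmap (E : C) : {s : hom E Z | True}.
  by apply: cid; have [z _] := Z1 E; exists z.
pose X' : arrow_category C := Arrow (sval (Zmap X)).
have sqP E (z : hom (src E) X) : sval (Zmap (tgt E)) \oc arr E = arr X' \oc z.
  exact: Zeq.
pose sq E z : @hom (arrow_category C) E X' := @Square C E X' _ _ (sqP E z).
have sq_inj E (s : @hom (arrow_category C) E X') : s = sq E (sq_src s).
  by apply: square_eq => //; exact: Zeq.
have e : sq B x \oc f = sq D y \oc g.
  by rewrite [LHS]sq_inj [RHS]sq_inj; congr sq.
have [h [[hu hv] hU]] := uvU _ _ _ e.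
exists (sq_src h); split.
  by rewrite -[x]/(sq_src (sq B x)) -hu -[y]/(sq_src (sq D y)) -hv.
move=> k [ku kv]; rewrite (hU (sq P k))//.
by split; rewrite [LHS]sq_inj; congr sq.
Qed.

End ArrowPushouts.

End Pushouts.

Section ExactSquare.
Variables (R : pzRingType) (A B D P : chain_complex R).
Variables (f : chain_map A B) (g : chain_map A D).
Variables (u : chain_map B P) (v : chain_map D P).

(** Exactness of A -> B + D -> P -> 0 in each degree. Unlike the universal property, it can be
    checked summand by summand, which is how it passes to direct sums and mapping cylinders. *)
Record exact_square : Prop := ExactSquare {
  es_comm : forall n a, u n (f n a) = v n (g n a);
  es_surj : forall n y, exists b d, y = u n b + v n d;
  es_exact : forall n b d, u n b = v n d -> exists a, b = f n a /\ d = g n a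
}.

Hypothesis E : exact_square.

Lemma exact_square_ses : (forall n, injective (f n)) ->
  short_exact (dsum_pair f g) (dsum_copair u v).
Proof.
move=> fI; split=> [n x y [/fI//]|n a|n [b d] /=|n y] /=.
- by rewrite linearN (es_comm E) subrr.
- move=> /eqP; rewrite addr_eq0 -linearN => /eqP/(es_exact E)[a [-> dE]].
  by exists a; rewrite -dE opprK.
- by have [b [d ->]] := es_surj E y; exists (b, d).
Qed.

Lemma exact_square_inj n : injective (f n) -> injective (v n).
Proof.
move=> fI d d' vd; have [a []] : exists a, 0 = f n a /\ d - d' = g n a.
  by apply: (es_exact E); rewrite linear0 linearB /= vd subrr.
rewrite -(linear0 (f n)) => /fI <-; rewrite linear0.
exact: subr0_eq.
Qed.

Section Universal.
Variables (X : chain_complex R) (x : chain_map B X) (y : chain_map D X).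
Hypothesis xy : forall n a, x n (f n a) = y n (g n a).

Lemma exact_square_wd n b d b' d' : u n b + v n d = u n b' + v n d' ->
  x n b + y n d = x n b' + y n d'.
Proof.
move=> e; have [a [bE dE]] : exists a, b - b' = f n a /\ d' - d = g n a.
  apply: (es_exact E); rewrite !linearB /=; apply/eqP.
  by rewrite subr_eq addrAC eq_sym subr_eq addrC eq_sym e addrC.
apply/eqP; rewrite -subr_eq0 opprD addrACA -!linearB /= bE xy -[d - d']opprB dE.
by rewrite linearN subrr.
Qed.

Lemma exact_square_map : exists h : chain_map P X,
  forall n b d, h n (u n b + v n d) = x n b + y n d.
Proof.
have [h0 h0P] : exists h : forall n, P n -> X n,
    forall n b d, h n (u n b + v n d) = x n b + y n d.
  have hE : forall n, exists h : P n -> X n,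
      forall b d, h (u n b + v n d) = x n b + y n d.
    (* Decompositions of the elements of P are chosen arbitrarily; [exact_square_wd] makes the value
       independent of the choice, whence linearity. *)
    move=> n; have /choice[t tP] := es_surj E (n := n).
    have /choice[w wP] := tP.
    exists (fun z => x n (t z) + y n (w z)) => b d.
    by apply: exact_square_wd; rewrite -wP.
  exists (fun n => sval (cid (hE n))) => n.
  exact: svalP (cid (hE n)).
have h0lin n : linear (@h0 n).
  move=> a z w; have [b [d ->]] := es_surj E z.
  have [b' [d' ->]] := es_surj E w.
  rewrite scalerDr addrACA -!linearP !h0P /=.
  by rewrite !linearP scalerDr addrACA.
have h0bd n z : bd X n (h0 n z) = h0 (n - 1) (bd P n z).
  have [b [d ->]] := es_surj E z.
  by rewrite h0P !linearD /= !cmap_bd h0P.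
by exists (ChainMap h0lin h0bd).
Qed.

Lemma exact_square_universal :
  exists! h : chain_map P X, chain_comp h u = x /\ chain_comp h v = y.
Proof.
have [h hP] := exact_square_map; exists h; split.
  split; apply: chain_map_eq => n z /=.
    by have := hP n z 0; rewrite !linear0 !addr0.
  by have := hP n 0 z; rewrite !linear0 !add0r.
move=> k [kx ky]; apply: chain_map_eq => n z.
have [b [d ->]] := es_surj E z; rewrite hP linearD /= -kx -ky.
by [].
Qed.

End Universal.

End ExactSquare.

Lemma exact_square_iso (R : pzRingType) (A B D P P' : chain_complex R)
    (f : chain_map A B) (g : chain_map A D) (u : chain_map B P)
    (v : chain_map D P) (h : chain_map P P') (k : chain_map P' P) :
  exact_square f g u v -> (forall n, cancel (h n) (k n)) ->
  (forall n, cancel (k n) (h n)) ->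
  exact_square f g (chain_comp h u) (chain_comp h v).
Proof.
move=> E hK kK; split=> /= [n a|n y|n b d].
- by rewrite (es_comm E).
- have [b [d ye]] := es_surj E (k n y).
  by exists b, d; rewrite -linearD /= -ye kK.
- by move=> /(can_inj (hK n)); exact: (es_exact E).
Qed.

Lemma coker_exact_square (R : pzRingType) (A B D : chain_complex R)
    (f : chain_map A B) (g : chain_map A D) : (forall n, injective (f n)) ->
  exact_square f g
    (chain_comp (coker_proj (dsum_pair f g)) (dsum_in1 B D))
    (chain_comp (coker_proj (dsum_pair f g)) (dsum_in2 B D)).
Proof.
move=> fI; have kI n : injective (dsum_pair f g n) by move=> x y [/fI].
have S := coker_short_exact kI; set p := coker_proj _ in S *.
have pE n b d : p n (b, d) = p n (b, 0) + p n (0, d).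
  by rewrite -linearD; congr (p n (_, _)); rewrite /= ?addr0 ?add0r.
have pN n d : p n (0, - d) = - p n (0, d).
  by rewrite -linearN; congr (p n (_, _)); rewrite /= oppr0.
split=> [n a|n y|n b d] /=.
- apply/eqP; rewrite -subr_eq0 -pN -pE; apply/eqP.
  exact: (ses_comp S).
- have [[b d] ->] := ses_surj S y; exists b, d; exact: pE.
- move=> /eqP; rewrite -subr_eq0 -pN -pE => /eqP/(ses_exact S).
  by move=> [a [-> /oppr_inj ->]]; exists a.
Qed.

(** * The category of admissible complexes *)

Section QuasiIsoTheory.
Variable R : pzRingType.
Implicit Types C D E : chain_complex R.

Lemma homology_map_comp C D E (g : chain_map D E) (f : chain_map C D) n :
  homology_map (chain_comp g f) (n := n) =1
  homology_map g (n := n) \o homology_map f (n := n).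
Proof.
move=> x; rewrite -[x]reprK /= !pi_homology_map.
by rewrite reprK; congr (\pi_(homology E n) _); apply/val_inj.
Qed.

Lemma quasi_iso_comp C D E (f : chain_map C D) (g : chain_map D E) :
  quasi_iso f -> quasi_iso g -> quasi_iso (chain_comp g f).
Proof.
move=> fQ gQ n; apply: eq_bij (bij_comp (gQ n) (fQ n)) _ _ => x.
by rewrite homology_map_comp.
Qed.

Lemma quasi_iso_cancelr C D E (f : chain_map C D) (g : chain_map D E) :
  quasi_iso f -> quasi_iso (chain_comp g f) -> quasi_iso g.
Proof.
move=> fQ gfQ n; have [f' fK f'K] := fQ n.
apply: (eq_bij (bij_comp (gfQ n) (Bijective f'K fK))) => x /=.
by rewrite homology_map_comp /= f'K.
Qed.

Lemma quasi_iso_cancell C D E (f : chain_map C D) (g : chain_map D E) :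
  quasi_iso g -> quasi_iso (chain_comp g f) -> quasi_iso f.
Proof.
move=> gQ gfQ n; have [g' gK g'K] := gQ n.
apply: (eq_bij (bij_comp (Bijective g'K gK) (gfQ n))) => x /=.
by rewrite homology_map_comp /= gK.
Qed.

Lemma quasi_iso_can C D (f : chain_map C D) (g : chain_map D C) :
  (forall n, cancel (f n) (g n)) -> (forall n, cancel (g n) (f n)) ->
  quasi_iso f.
Proof.
move=> fK gK; apply/quasi_isoP => n x y _ fx; exists (g n y); split.
  by rewrite cmap_bd -fx fK.
by rewrite gK subrr; exact: bnd0.
Qed.

Definition chain_inj C D (f : chain_map C D) : Prop :=
  forall n, injective (f n).

Lemma trivial_source C D (f g : chain_map C D) :
  (forall n (x : C n), x = 0) -> f = g.
Proof. by move=> C0; apply: chain_map_eq => n x; rewrite (C0 n x) !linear0. Qed.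

Lemma trivial_target C D (f g : chain_map C D) :
  (forall n (x : D n), x = 0) -> f = g.
Proof. by move=> D0; apply: chain_map_eq => n x; rewrite [LHS]D0 [RHS]D0. Qed.

Definition dsum_map C D C' D' (f : chain_map C C') (g : chain_map D D') :
    chain_map (dsum C D) (dsum C' D') :=
  dsum_copair (chain_comp (dsum_in1 C' D') f) (chain_comp (dsum_in2 C' D') g).

Lemma dsum_mapE C D C' D' (f : chain_map C C') (g : chain_map D D') n t :
  dsum_map f g n t = (f n t.1, g n t.2).
Proof. by congr (_, _); rewrite /= ?addr0 ?add0r. Qed.

Lemma quasi_iso_dsum C D C' D' (f : chain_map C C') (g : chain_map D D') :
  quasi_iso f -> quasi_iso g -> quasi_iso (dsum_map f g).
Proof.
move=> /quasi_isoP fQ /quasi_isoP gQ; apply/quasi_isoP.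
move=> n [x y] [x' y'] [Zx Zy]; rewrite dsum_mapE => -[fx gy].
have [z [xE bz]] := fQ _ _ _ Zx fx; have [w [yE bw]] := gQ _ _ _ Zy gy.
exists (z, w); rewrite dsum_mapE; split; first by congr (_, _).
have := submodD (bnd_sub _ n) (boundary_map (dsum_in1 C' D') bz)
  (boundary_map (dsum_in2 C' D') bw).
by congr boundary; congr (_, _); rewrite /= ?addr0 ?add0r.
Qed.

Lemma quasi_iso_mapcyl_p C D (f : chain_map C D) : quasi_iso (mapcyl_p f).
Proof.
apply/quasi_isoP => n [[x x'] y] z [/eqP + _ _] /= e.
(* A cycle has x' = dx, and [e] reads f x + y = dz. The differential sends (0, - x, z) to (x, dx, dz
   - f x), which is the given triple. *)
rewrite subr_eq0 => /eqP xx'; exists (0, - x, z); split.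
  congr (_, _, _); rewrite /= ?linear0 ?sub0r ?opprK ?linearN ?opprK//.
  by rewrite -e /= addrAC subrr add0r.
by rewrite /= linear0 add0r subrr; exact: bnd0.
Qed.

Lemma dsum_exact_square (A B D P A' B' D' P' : chain_complex R)
    (f : chain_map A B) (g : chain_map A D) (u : chain_map B P)
    (v : chain_map D P) (f' : chain_map A' B') (g' : chain_map A' D')
    (u' : chain_map B' P') (v' : chain_map D' P') :
  exact_square f g u v -> exact_square f' g' u' v' ->
  exact_square (dsum_map f f') (dsum_map g g') (dsum_map u u') (dsum_map v v').
Proof.
move=> E E'; split=> [n [a a']|n [y y']|n [b b'] [d d']].
- by rewrite !dsum_mapE /= (es_comm E) (es_comm E').
- have [b [d ->]] := es_surj E y; have [b' [d' ->]] := es_surj E' y'.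
  by exists (b, b'), (d, d'); rewrite !dsum_mapE.
- rewrite !dsum_mapE => -[/(es_exact E)[a [-> ->]] /(es_exact E')[a' [-> ->]]].
  by exists (a, a'); rewrite !dsum_mapE.
Qed.

Local Notation cplx := (complex_category R).

Lemma mapcyl_exact_square (A B D P : arrow_category cplx)
    (f : hom A B) (g : hom A D) (u : hom B P) (v : hom D P) :
  exact_square (sq_src f) (sq_src g) (sq_src u) (sq_src v) ->
  exact_square (sq_tgt f) (sq_tgt g) (sq_tgt u) (sq_tgt v) ->
  exact_square (mapcyl_map f) (mapcyl_map g) (mapcyl_map u) (mapcyl_map v).
Proof.
move=> E E'; split=> [n [[a a'] x]|n [[y y'] z]|n [[b b'] x] [[d d'] y]] /=.
- by rewrite !(es_comm E) (es_comm E').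
- have [b [d ->]] := es_surj E y; have [b' [d' ->]] := es_surj E y'.
  have [x [w ->]] := es_surj E' z.
  by exists (b, b', x), (d, d', w).
- move=> [/(es_exact E)[a [-> ->]] /(es_exact E)[a' [-> ->]]].
  move=> /(es_exact E')[z [-> ->]].
  by exists (a, a', z).
Qed.

(* The arrow C v D -> T(f) *)
Definition mapcyl_front C D (f : chain_map C D) :
    chain_map (dsum C D) (mapcyl f) :=
  dsum_copair (mapcyl_j1 f) (mapcyl_j2 f).

Lemma mapcyl_frontE C D (f : chain_map C D) n t :
  mapcyl_front f n t = (t.1, 0, t.2).
Proof. by congr (_, _, _); rewrite /= ?addr0 ?add0r. Qed.

Lemma mapcyl_front_inj C D (f : chain_map C D) n :
  injective (mapcyl_front f n).
Proof. by move=> [x y] [x' y']; rewrite !mapcyl_frontE => -[-> ->]. Qed.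

(** Degreewise, P is the sum of the source of B in degree n, the source of A in degree n - 1 and the
    target of B; h is the identity on the outer summands and [sq_src s] on the middle one. *)
Lemma mapcyl_front_cof (A B : arrow_category cplx) (s : hom A B)
    (P : chain_complex R) (u : chain_map (dsum (src B) (tgt B)) P)
    (v : chain_map (mapcyl (arr A)) P) (h : chain_map P (mapcyl (arr B))) :
  (forall n, injective (cmap (sq_src s) n)) ->
  (forall n, injective (cmap (sq_tgt s) n)) ->
  exact_square (dsum_map (sq_src s) (sq_tgt s)) (mapcyl_front (arr A)) u v ->
  (forall n t, h n (u n t) = mapcyl_front (arr B) n t) ->
  (forall n t, h n (v n t) = mapcyl_map s n t) ->
  forall n, injective (h n).
Proof.
move=> sI tI E hu hv n; suff h0 y : h n y = 0 -> y = 0.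
  by move=> y z yz; apply/subr0_eq/h0; rewrite linearB /= yz subrr.
have [[b b'] [[[a a'] c] ->]] := es_surj E y.
rewrite linearD /= hu hv mapcyl_frontE => -[/= e1 e2 e3].
have {e2} a'0 : a' = 0 by apply: sI; rewrite linear0 -[LHS]add0r.
(* The outer coordinates show that (b, b') comes from (- a, - c); moved across the square, it
   cancels a and c. *)
have b1 : b = cmap (sq_src s) n (- a).
  by rewrite linearN; apply/eqP; rewrite -addr_eq0 e1.
have b2 : b' = cmap (sq_tgt s) n (- c).
  by rewrite linearN; apply/eqP; rewrite -addr_eq0 e3.
have -> : (b, b') = dsum_map (sq_src s) (sq_tgt s) n (- a, - c).
  by rewrite dsum_mapE b1 b2.
rewrite (es_comm E) -linearD mapcyl_frontE a'0 -[RHS](linear0 (v n)).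
by congr (v n (_, _, _)); rewrite /= ?addNr ?addr0.
Qed.

End QuasiIsoTheory.

Section AdmissibleCategory.
Variables (K : realType) (R : idomainType).
Hypothesis hR : noetherian R.
Local Notation adm := (admissible_complexes K R).
Implicit Types A B D P Z : adm.

Lemma adm_zeroP Z : is_zero Z <-> forall n (x : sval Z n), x = 0.
Proof.
split=> [[Z0 _] n x|Z0].
  (* The identity and the zero map are endomorphisms of an initial object, hence equal. *)
  have [e [_ eU]] := Z0 Z.
  have e0 := etrans (esym (eU (idm Z) I)) (eU (zero_map (sval Z) (sval Z)) I).
  exact: (congr1 (fun h : chain_map _ _ => h n x) e0).
split=> A.
  by exists (zero_map (sval Z) (sval A)); split=> // f _; apply: trivial_source.
by exists (zero_map (sval A) (sval Z)); split=> // f _; apply: trivial_target.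
Qed.

Lemma adm_has_zero : exists Z : adm, is_zero Z.
Proof.
have Z0 n (x : zero_complex R n) : x = 0 by apply/rowP; case.
by exists (exist _ (zero_complex R) (trivial_admissible K Z0)); apply/adm_zeroP.
Qed.

Definition adm_coproducts : coproducts adm.
Proof.
refine (@Coproducts adm
  (fun A B => exist _ (dsum (sval A) (sval B))
    (admissible_dsum hR (svalP A) (svalP B)))
  (fun A B => dsum_in1 (sval A) (sval B))
  (fun A B => dsum_in2 (sval A) (sval B))
  (fun A B X f g => dsum_copair f g) _ _ _).
- by move=> A B X f g; apply: chain_map_eq => n x /=; rewrite linear0 addr0.
- by move=> A B X f g; apply: chain_map_eq => n x /=; rewrite linear0 add0r.
- move=> A B X h k h1 h2; apply: chain_map_eq => n [x y].
  have -> : (x, y) =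
      dsum_in1 (sval A) (sval B) n x + dsum_in2 (sval A) (sval B) n y.
    by congr (_, _); rewrite /= ?addr0 ?add0r.
  rewrite !linearD /=; congr (_ + _).
    exact: (congr1 (fun h : chain_map _ _ => h n x) h1).
  exact: (congr1 (fun h : chain_map _ _ => h n y) h2).
Defined.

Lemma adm_isoP A B (f : chain_map (sval A) (sval B)) :
  @is_iso adm A B f -> exists g : chain_map (sval B) (sval A),
    (forall n, cancel (f n) (g n)) /\ (forall n, cancel (g n) (f n)).
Proof.
move=> [g [gf fg]]; exists g; split=> n x.
  exact: (congr1 (fun h : chain_map _ _ => h n x) gf).
exact: (congr1 (fun h : chain_map _ _ => h n x) fg).
Qed.

Section Pushout.
Variables (A B D P : adm).
Variables (f : chain_map (sval A) (sval B)) (g : chain_map (sval A) (sval D)).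
Variables (u : chain_map (sval B) (sval P)) (v : chain_map (sval D) (sval P)).

Lemma adm_pushout : exact_square f g u v -> @is_pushout adm A B D P f g u v.
Proof.
move=> E; split; first by apply: chain_map_eq => n x; exact: (es_comm E).
move=> X x y xy; apply: (exact_square_universal E) => n a.
exact: (congr1 (fun h : chain_map _ _ => h n a) xy).
Qed.

End Pushout.

Lemma adm_pushout_exists A B D (f : chain_map (sval A) (sval B))
    (g : chain_map (sval A) (sval D)) : (forall n, injective (f n)) ->
  exists P (u : chain_map (sval B) (sval P)) (v : chain_map (sval D) (sval P)),
    exact_square f g u v.
Proof.
move=> fI; have kI n : injective (dsum_pair f g n) by move=> x y [/fI].
have admP := admissible_quotient (coker_short_exact kI) hR (svalP A)
  (admissible_dsum hR (svalP B) (svalP D)).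
by exists (exist _ _ admP); do 2 eexists; exact: coker_exact_square.
Qed.

(** The universal property in the full subcategory is tested on admissible complexes only. As the
    cokernel pushout is itself admissible, any other pushout is isomorphic to it and inherits
    exactness. *)
Lemma adm_pushout_exact A B D P (f : chain_map (sval A) (sval B))
    (g : chain_map (sval A) (sval D)) (u : chain_map (sval B) (sval P))
    (v : chain_map (sval D) (sval P)) : (forall n, injective (f n)) ->
  @is_pushout adm A B D P f g u v -> exact_square f g u v.
Proof.
move=> fI fguv; have [P0 [u0 [v0 E]]] := adm_pushout_exists g fI.
have [h [/adm_isoP[k [hK kK]] <- <-]] := pushout_iso (adm_pushout E) fguv.
exact: exact_square_iso E hK kK.
Qed.

Lemma adm_is_waldhausen : is_waldhausen adm.
Proof.
split.
- exact: adm_has_zero.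
- by move=> A B D f g fI gI n x y /gI/fI.
- by move=> A B D f g; exact: quasi_iso_comp.
- by move=> A B f /adm_isoP[g [fK _]] n; exact: can_inj (fK n).
- move=> Z A f /adm_zeroP Z0 n x y _; by rewrite (Z0 n x) (Z0 n y).
- move=> A B D f g fI; split=> [|P u v /(adm_pushout_exact fI) E n].
    have [P [u [v E]]] := adm_pushout_exists g fI.
    by exists P, u, v; exact: adm_pushout.
  exact: (exact_square_inj E) (fI n).
- by move=> A B f /adm_isoP[g [fK gK]]; exact: quasi_iso_can fK gK.
- move=> A B D A' B' D' f g f' g' a b d bf dg fI f'I aQ bQ dQ P P' u v u' v' h.
  move=> /(adm_pushout_exact fI) E /(adm_pushout_exact f'I) E' hu hv.
  (* In the sequences A -> B + D -> P of both squares, the map on the middle terms is the sum of b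
     and d, and h is the induced map of quotients. *)
  apply/quasi_isoP; apply: (five_quotient (exact_square_ses E fI)
    (exact_square_ses E' f'I) (a := a) (e := dsum_map b d)).
  + move=> n x; rewrite dsum_mapE /= linearN; congr (_, - _).
      exact: (congr1 (fun h : chain_map _ _ => h n x) bf).
    exact: (congr1 (fun h : chain_map _ _ => h n x) dg).
  + move=> n x; rewrite dsum_mapE /= linearD; congr (_ + _).
      exact: (congr1 (fun h : chain_map _ _ => h n x.1) hu).
    exact: (congr1 (fun h : chain_map _ _ => h n x.2) hv).
  + exact/quasi_isoP.
  + by apply/quasi_isoP; exact: quasi_iso_dsum.
Qed.

Lemma adm_saturation : saturation adm.
Proof.
move=> A B D f g; split; [exact: quasi_iso_comp|exact: quasi_iso_cancelr|
  exact: quasi_iso_cancell].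
Qed.

(** With a zero complex in one corner, the exact square reduces to exactness of A -> B -> D. *)
Lemma adm_cofibration_sequence A B D (f : chain_map (sval A) (sval B))
    (q : chain_map (sval B) (sval D)) :
  @cofibration_sequence adm A B D f q -> short_exact f q.
Proof.
move=> [fI [Z [z [s [/adm_zeroP Z0 /(adm_pushout_exact fI) E]]]]].
split=> // [n a|n e|n y].
- by rewrite (es_comm E) (Z0 n (cmap z n a)) linear0.
- rewrite -(linear0 (cmap s n)) => /(es_exact E)[a [-> _]].
  by exists a.
- have [b [d ->]] := es_surj E y; exists b.
  by rewrite (Z0 n d) linear0 addr0.
Qed.

Lemma adm_extension : extension adm.
Proof.
move=> A B D A' B' D' f q f' q' a b d.
move=> /adm_cofibration_sequence S /adm_cofibration_sequence S' bf dq aQ dQ.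
apply/quasi_isoP; apply: (five_middle S S' (a := a) (h := d)).
- by move=> n x; exact: (congr1 (fun h : chain_map _ _ => h n x) bf).
- by move=> n x; exact: (congr1 (fun h : chain_map _ _ => h n x) dq).
- exact/quasi_isoP.
- exact/quasi_isoP.
Qed.

(** * The cylinder functor on admissible complexes *)

Lemma admissible_mapcyl (f : arrow (complex_category R)) :
  admissible K (src f) -> admissible K (tgt f) ->
  admissible K (mapping_cylinder R f).
Proof.
move=> [C0 _ _ _] admD; have [D0 _ _ _] := admD.
(* The projection p identifies the homology with that of the target; what remains is vanishing in
   negative degrees, including the summand of degree n - 1. *)
apply: (admissible_quasi_iso _ (quasi_iso_mapcyl_p (arr f)) admD).
move=> n n0 [[x x'] y]; rewrite (C0 n n0 x) (D0 n n0 y) (C0 (n - 1) _ x')//.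
by rewrite ltrBlDr (lt_trans n0).
Qed.

Local Notation T := (cyl_restrict admissible_mapcyl : cylinder adm).

Lemma mapcyl_cylinder_axiom : cylinder_axiom (W := adm) T.
Proof. by move=> f; exact: quasi_iso_mapcyl_p. Qed.

Lemma mapcyl_Cyl2 : Cyl2 (W := adm) T.
Proof.
move=> f /adm_zeroP Z0; apply: chain_map_eq => n [[x x'] y].
by rewrite (Z0 n x) (Z0 (n - 1) x') /= linear0 add0r.
Qed.

Lemma mapcyl_front_adm (f : arrow adm) :
  cof (arr (cyl_front (W := adm) T adm_coproducts f)).
Proof. by move=> n; exact: mapcyl_front_inj. Qed.

Lemma arrow_adm_zero (A : arrow_cw adm) : is_zero A ->
  (forall n (x : sval (src A) n), x = 0) /\
  (forall n (x : sval (tgt A) n), x = 0).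
Proof.
move=> [A0 _]; have [e [_ eU]] := A0 A.
have sq0 : @comp adm _ _ _ (zero_map (sval (tgt A)) (sval (tgt A))) (arr A) =
    @comp adm _ _ _ (arr A) (zero_map (sval (src A)) (sval (src A))).
  by apply: chain_map_eq => n x /=; rewrite linear0.
have e0 := etrans (esym (eU (idm A) I)) (eU (@Square adm A A _ _ sq0) I).
split=> n x.
  exact: (congr1 (fun s : square A A => cmap (sq_src s) n x) e0).
exact: (congr1 (fun s : square A A => cmap (sq_tgt s) n x) e0).
Qed.

Lemma adm_cosum_mapE A B A' B' (a : chain_map (sval A) (sval A'))
    (b : chain_map (sval B) (sval B')) :
  @cosum_map adm adm_coproducts A B A' B' a b = dsum_map a b.
Proof. by []. Qed.

Lemma adm_frontE (A : arrow adm) :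
  arr (cyl_front T adm_coproducts A) = mapcyl_front (arr A).
Proof. by []. Qed.

Section FrontMap.
Variables (A B : arrow adm) (s : square A B).

Lemma adm_front_srcE :
  sq_src (cyl_front_map T adm_coproducts s) = dsum_map (sq_src s) (sq_tgt s).
Proof. exact: adm_cosum_mapE. Qed.

Lemma adm_front_tgtE :
  sq_tgt (cyl_front_map T adm_coproducts s) = mapcyl_map (square_incl s).
Proof. by []. Qed.

Lemma adm_front_weq : weq (sq_src s) -> weq (sq_tgt s) ->
  weq (sq_src (cyl_front_map T adm_coproducts s)) /\
  weq (sq_tgt (cyl_front_map T adm_coproducts s)).
Proof.
move=> sQ tQ; rewrite adm_front_srcE adm_front_tgtE.
split; first exact: quasi_iso_dsum sQ tQ.
(* Naturality of p puts the map of cylinders in a square with [sq_tgt s] whose other sides are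
   projections p; two out of three applies. *)
apply: (quasi_iso_cancell (quasi_iso_mapcyl_p (arr B))).
have <- : chain_comp (sq_tgt s) (mapcyl_p (arr A)) =
    chain_comp (mapcyl_p (arr B)) (mapcyl_map (square_incl s)).
  exact: esym (ntr_nat (cyl_p (mapping_cylinder R)) (square_incl s)).
exact: quasi_iso_comp (quasi_iso_mapcyl_p _) tQ.
Qed.

Hypotheses (sI : cof (sq_src s)) (tI : cof (sq_tgt s)).

Let front_src_inj : chain_inj (dsum_map (sq_src s) (sq_tgt s)).
Proof. by move=> n [x y] [x' y']; rewrite !dsum_mapE => -[/sI -> /tI ->]. Qed.

Lemma adm_front_src_cof : cof (sq_src (cyl_front_map T adm_coproducts s)).
Proof. by rewrite adm_front_srcE; exact: front_src_inj. Qed.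

Lemma adm_front_pushout_exists : exists (P : adm)
    (u : hom (cosum adm_coproducts (src B) (tgt B)) P) (v : hom (T A) P),
  exact_square (dsum_map (sq_src s) (sq_tgt s)) (mapcyl_front (arr A)) u v.
Proof.
have := @adm_pushout_exists (cosum adm_coproducts (src A) (tgt A))
  (cosum adm_coproducts (src B) (tgt B)) (T A)
  (dsum_map (sq_src s) (sq_tgt s)) (mapcyl_front (arr A)).
exact.
Qed.

Section Induced.
Variables (P : adm) (u : hom (cosum adm_coproducts (src B) (tgt B)) P).
Variables (v : hom (T A) P).
Hypothesis E :
  exact_square (dsum_map (sq_src s) (sq_tgt s)) (mapcyl_front (arr A)) u v.

Lemma adm_front_pushout :
  is_pushout (sq_src (cyl_front_map T adm_coproducts s))
    (arr (cyl_front T adm_coproducts A)) u v.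
Proof.
rewrite adm_front_srcE adm_frontE.
exact: (@adm_pushout (cosum adm_coproducts (src A) (tgt A))
  (cosum adm_coproducts (src B) (tgt B)) (T A) P _ _ _ _ E).
Qed.

Lemma adm_front_induced_inj (h : chain_map (sval P) (mapcyl (arr B))) :
  chain_comp h u = mapcyl_front (arr B) ->
  chain_comp h v = mapcyl_map (square_incl s) -> chain_inj h.
Proof.
move=> hu hv; apply: (@mapcyl_front_cof R (arrow_incl A) (arrow_incl B)
  (square_incl s) (sval P) u v h sI tI E) => n x.
  by rewrite -hu.
by rewrite -hv.
Qed.

End Induced.

Lemma adm_front_cof : @cofibration_map_cof adm
  (cyl_front_functor mapcyl_front_adm A) (cyl_front_functor mapcyl_front_adm B)
  (cyl_front_map T adm_coproducts s).
Proof.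
split; first exact: adm_front_src_cof.
(* The pushout is taken as an exact square, since injectivity of [h] is checked on elements written
   as sums from the two legs. *)
have [P [u [v E]]] := adm_front_pushout_exists.
have p := adm_front_pushout E.
have [h [[hu hv] _]] := p.2 _ _ _
  (esym (sq_comm (cyl_front_map T adm_coproducts s))).
exists P, u, v, h; split; [exact: p|exact: hu|exact: hv|].
rewrite adm_frontE in hu; rewrite adm_front_tgtE in hv.
exact: (adm_front_induced_inj E hu hv).
Qed.

End FrontMap.

Lemma adm_front_square (A B D P : arrow_category adm) (f : hom A B)
    (g : hom A D) (u : hom B P) (v : hom D P) :
  exact_square (sq_src f) (sq_src g) (sq_src u) (sq_src v) ->
  exact_square (sq_tgt f) (sq_tgt g) (sq_tgt u) (sq_tgt v) ->
  @is_pushout (arrow_category adm) _ _ _ _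
    (cyl_front_map T adm_coproducts f) (cyl_front_map T adm_coproducts g)
    (cyl_front_map T adm_coproducts u) (cyl_front_map T adm_coproducts v).
Proof.
move=> Es Et; apply: arrow_pushout; rewrite ?adm_front_srcE ?adm_front_tgtE.
  pose S (E : arrow adm) := cosum adm_coproducts (src E) (tgt E).
  exact: (@adm_pushout (S A) (S B) (S D) (S P) _ _ _ _
    (dsum_exact_square Es Et)).
exact: (@adm_pushout (T A) (T B) (T D) (T P) _ _ _ _
  (mapcyl_exact_square (f := square_incl f) (g := square_incl g)
    (u := square_incl u) (v := square_incl v) Es Et)).
Qed.

Lemma mapcyl_Cyl1 : Cyl1 (W := adm) T.
Proof.
exists adm_coproducts, mapcyl_front_adm; split.
- move=> A /arrow_adm_zero[A0 A0'].
  pose F := cyl_front_functor mapcyl_front_adm A.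
  have F0 n (x : sval (src (sval F)) n) : x = 0.
    by case: x => x y; rewrite (A0 n x) (A0' n y).
  have F0' n (x : sval (tgt (sval F)) n) : x = 0.
    by case: x => [[x x'] y]; rewrite (A0 n x) (A0 (n - 1) x') (A0' n y).
  (* Both components of F vanish, so the zero square is the only map in either direction. *)
  split=> X.
    have sq0 :
        @comp adm _ _ _ (zero_map _ (sval (tgt (sval X)))) (arr (sval F)) =
        @comp adm _ _ _ (arr (sval X)) (zero_map _ (sval (src (sval X)))).
      exact: trivial_source.
    exists (@Square adm (sval F) (sval X) _ _ sq0); split=> // s _.
    by apply: square_eq; apply: trivial_source.
  have sq0 : @comp adm _ _ _ (zero_map (sval (tgt (sval X))) _) (arr (sval X)) =
      @comp adm _ _ _ (arr (sval F)) (zero_map (sval (src (sval X))) _).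
    exact: trivial_target.
  exists (@Square adm (sval X) (sval F) _ _ sq0); split=> // s _.
  by apply: square_eq; apply: trivial_target.
- by move=> A B s [sI tI]; exact: adm_front_cof.
- by move=> A B s [sQ tQ]; exact: adm_front_weq.
- move=> A B D P f g u v [sI tI] fguv.
  (* Cofibrations of arrows are injective in both components, so a pushout of arrows gives two exact
     squares, from which direct sum and cylinder build the required one. *)
  have Es := adm_pushout_exact sI (arrow_pushout_src adm_has_zero fguv).
  have Et := adm_pushout_exact tI (arrow_pushout_tgt fguv).
  have [c U] := adm_front_square Es Et.
  split; first exact: c.
  (* Maps of cofibrations are squares, so the universal property among all arrows restricts to
     cofibrations. *)
  by move=> X; exact: (U (sval X)).
Qed.

End AdmissibleCategory.

Theorem theorem5p1 (K : realType) (R : idomainType) (hR : noetherian R) :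
  [/\ is_waldhausen (admissible_complexes K R),
      saturation (admissible_complexes K R) &
      extension (admissible_complexes K R)] /\
  (exists adm_cyl : forall f : arrow (complex_category R),
      admissible K (src f) -> admissible K (tgt f) ->
      admissible K (mapping_cylinder R f),
    is_cylinder_functor (W := admissible_complexes K R) (cyl_restrict adm_cyl) /\
    cylinder_axiom (W := admissible_complexes K R) (cyl_restrict adm_cyl)).
Proof.
split; first split.
- exact: adm_is_waldhausen.
- exact: adm_saturation.
- exact: adm_extension.
exists (@admissible_mapcyl K R); split; last exact: mapcyl_cylinder_axiom.
split; [exact: mapcyl_Cyl1 | exact: mapcyl_Cyl2].
Qed.
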